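(* Let $S(1)=\tilde N^*(S^1)=\mathbb{F}\cdot\mathbf{e}$ and $C(1)=\tilde N^*(\Delta^1)=\mathbb{F}\cdot\mathbf{e}\oplus\mathbb{F}\cdot\mathbf{c}$ carry the $\mathcal{E}$-algebra structures of reduced normalized cochain complexes. Let $r\ge1$ and $w\in\mathcal{E}(r)$. 1) The evaluation product of the circle algebra $S(1)$ is given by $$w(\mathbf{e}_{(1)},\ldots,\mathbf{e}_{(r)})=(-1)^{\sigma}\cdot\epsilon_r(w)\cdot\mathbf{e},\qquad \sigma=r(r-1)/2.$$ 2) The evaluation product of the cone algebra $C(1)$ is characterized by the equations: $$\text{(i)}\quad w(\mathbf{e}_{(1)},\ldots,\mathbf{e}_{(r)})=(-1)^{\sigma}\cdot\epsilon_r(w)\cdot\mathbf{e},$$ $$\text{(ii)}\quad w(\mathbf{e}_{(1)},\ldots,\mathbf{e}_{(s)},\mathbf{c}_{(s+1)},\ldots,\mathbf{c}_{(r)})=(-1)^{\sigma}\cdot\epsilon_s(w)\cdot\mathbf{e}\qquad(0<s<r),$$ $$\text{(iii)}\quad w(\mathbf{c}_{(1)},\ldots,\mathbf{c}_{(r)})=(-1)^{\sigma}\cdot\epsilon_0(w)\cdot\mathbf{c},$$ where $\sigma=s(s-1)/2$, with $s=r$ in (i) and $s=0$ in (iii). (The subscripts specify the places of the copies of $\mathbf{e}$ and $\mathbf{c}$.)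
   Context: $\mathbb{F}$ is a fixed commutative ground ring; dg-modules use the Koszul sign rule. $\tilde N_*$, $\tilde N^*$ denote reduced normalized (co)chains of pointed simplicial sets. $S^1=\Delta^1/\partial\Delta^1$; $\mathbf{e}\in\tilde N^1(S^1)$ is dual to $\Delta(0,1)$. The interval $\Delta^1$ has base point $\Delta(0)$; $\mathbf{e}\in\tilde N^1(\Delta^1)$ and $\mathbf{c}\in\tilde N^0(\Delta^1)$ are dual to $\Delta(0,1)$ and $\Delta(1)$, with $\delta(\mathbf{c})=\mathbf{e}$. Cochains $\epsilon_s:\mathcal{E}(r)_*\to\mathbb{F}$, for $s\ge1$: $\epsilon_s(w_0,\ldots,w_d)=\mathrm{sgn}(w_0(1),\ldots,w_d(1))$ if $d=s-1$ and the sequence $(w_0(1),\ldots,w_d(1))$ is a permutation of $(1,\ldots,s)$, and $0$ otherwise. $\epsilon_0$ is the augmentation: $\epsilon_0(w_0)=1$, and $\epsilon_0=0$ in positive degrees. $\mathcal{E}(r)_d$ (Barratt-Eccles operad) is generated by $(d+1)$-tuples $(w_0,\ldots,w_d)$ of elements of $\Sigma_r$, each written as its sequence of values, modulo tuples with $w_i=w_{i+1}$ for some $i$; $\Sigma_r$ acts diagonally on the left. Evaluation products are $\Sigma_r$-equivariant: $(\sigma\cdot w)(a_1,\ldots,a_r)=w(a_{\sigma(1)},\ldots,a_{\sigma(r)})$ up to Koszul signs. The $\mathcal{E}$-algebra structure (in arities $r\ge1$ on reduced cochains) is dual to cooperations $w^*=AW(TR(w)):N_*(X)\to N_*(X)^{\otimes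 r}$, i.e. $w(f_1,\ldots,f_r)(x)=(-1)^{\deg(w)(\deg f_1+\cdots+\deg f_r)}\langle f_1\otimes\cdots\otimes f_r\,|\,w^*(x)\rangle$ with the Koszul sign in the pairing (so that $\langle\mathbf{e}^{\otimes s}\otimes\mathbf{c}^{\otimes r-s}|\Delta(0,1)^{\otimes s}\otimes\Delta(1)^{\otimes r-s}\rangle=(-1)^{s(s-1)/2}$). It is defined as follows. $TR$: let $\mathcal{X}(r)_d$ be the $\mathbb{F}$-module generated by the surjections $u:\{1,\ldots,r+d\}\to\{1,\ldots,r\}$, written $(u(1),\ldots,u(r+d))$, with degenerate ones ($u(i)=u(i+1)$ for some $i$) and non-surjective maps set to zero. $TR(w_0,\ldots,w_d)=\sum w'$ over all $r_0,\ldots,r_d\ge1$ with $\sum r_i=r+d$, where $w'$ is the concatenation of lines of lengths $r_0,\ldots,r_d$, line $i$ consisting of the first $r_i$ terms of $(w_i(1),\ldots,w_i(r))$ that do not occur among the non-final entries of the preceding lines (the last entry of each preceding line is disregarded). $AW$: for $u\in\mathcal{X}(r)_d$ and an $n$-simplex $x$, $AW(u)(x)=\sum\pm x(C_{(1)})\otimes\cdots\otimes x(C_{(r)})$ over $0=n_0\le n_1\le\cdots\le n_{r+d}=n$, where $C_{(k)}$ is the concatenation, in increasing order of $i$, of the intervals $n_{i-1},\ldots,n_i$ with $u(i)=k$, and $x(c_0,\ldots,c_m)$ is the image of $x$ under the simplicial operator given by the sequence. The $i$-th interval is final if $u(i)$ is the last occurrence of its value in $u$, inner otherwise; its length is $n_i-n_{i-1}$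 if final and $n_i-n_{i-1}+1$ if inner. The sign is the product of $(-1)^{\sum n_i}$ over the inner intervals $[n_{i-1},n_i]$ and of the Koszul sign of the shuffle of intervals taking $(u(1),\ldots,u(r+d))$ to the ordered sequence $(1,\ldots,1,2,\ldots,2,\ldots,r,\ldots,r)$, with the lengths as degrees. *)

(* Defs.v *)
From HB Require Import structures.
From mathcomp Require Import all_boot all_order all_fingroup all_algebra.
From mathcomp Require Import boolp functions zify.

Set Implicit Arguments.
Unset Strict Implicit.
Unset Printing Implicit Defensive.

Import GRing.Theory.
Local Open Scope ring_scope.

(** The index sets {1, ..., r} are rendered by ['I_r], hence with values shifted
    by one throughout. *)

Definition monotone m n (a : {ffun 'I_m.+1 -> 'I_n.+1}) : bool :=
  [forall i : 'I_m.+1, forall j : 'I_m.+1, (i <= j)%N ==> (a i <= a j)%N].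

Record smap m n := Smap {
  smap_fun :> {ffun 'I_m.+1 -> 'I_n.+1};
  _ : monotone smap_fun
}.
HB.instance Definition _ m n := [isSub for @smap_fun m n].
HB.instance Definition _ m n := [Finite of smap m n by <:].

Lemma smap_mono m n (a : smap m n) (i j : 'I_m.+1) :
  (i <= j)%N -> (a i <= a j)%N.
Proof.
by move=> ij; move/forallP/(_ i)/forallP/(_ j)/implyP: (valP a) => ->.
Qed.

Lemma sid_subproof n : monotone [ffun i : 'I_n.+1 => i].
Proof.
by apply/forallP=> i; apply/forallP=> j; rewrite !ffunE; apply/implyP.
Qed.

Definition sid n : smap n n := Smap (sid_subproof n).

Lemma scomp_subproof l m n (a : smap m n) (b : smap l m) :
  monotone [ffun i => a (b i)].
Proof.
apply/forallP=> i; apply/forallP=> j; apply/implyP=> ij; rewrite !ffunE.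
by do 2!apply: smap_mono.
Qed.

Definition scomp l m n (a : smap m n) (b : smap l m) : smap l n :=
  Smap (scomp_subproof a b).

Lemma sconst_subproof m n (i : 'I_n.+1) : monotone [ffun _ : 'I_m.+1 => i].
Proof.
by apply/forallP=> j; apply/forallP=> k; rewrite !ffunE leqnn implybT.
Qed.

Definition sconst m n (i : 'I_n.+1) : smap m n := Smap (sconst_subproof m i).

(** The operator [m] -> [n] given by a sequence (c_0, ..., c_m); the default
    value is irrelevant for nonempty nondecreasing sequences bounded by n. *)
Definition seq_smap n (c : seq nat) : smap (size c).-1 n :=
  insubd (sconst _ ord0) [ffun i : 'I_(size c).-1.+1 => inord (nth 0%N c i)].

Record sset := SSet {
  cell :> nat -> eqType;
  sact : forall m n, smap m n -> cell n -> cell m;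
  sact_id : forall n (x : cell n), sact (sid n) x = x;
  sact_comp : forall l m n (a : smap m n) (b : smap l m) (x : cell n),
    sact (scomp a b) x = sact b (sact a x)
}.

Record psset := PSSet { psset_sset :> sset; basept : psset_sset 0%N }.

Definition simplex (X : sset) := {n : nat & cell X n}.
HB.instance Definition _ (X : sset) := Equality.on (simplex X).

Definition Simplex (X : sset) n (x : X n) : simplex X := Tagged (cell X) x.

Definition sdim (X : sset) (x : simplex X) : nat := tag x.

(** [vertices x c] is x(c_0, ..., c_m). *)
Definition vertices (X : sset) (x : simplex X) (c : seq nat) : simplex X :=
  Simplex (sact (seq_smap (sdim x) c) (tagged x)).

Definition degenerate (X : sset) (x : simplex X) : Prop :=
  exists m (a : smap (sdim x) m) (y : X m),
    (m < sdim x)%N /\ tagged x = sact a y.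

Lemma Delta_id n m (x : smap m n) : scomp x (sid m) = x.
Proof. by apply: val_inj; apply/ffunP=> i; rewrite /= !ffunE. Qed.

Lemma Delta_comp n l m k (a : smap m k) (b : smap l m) (x : smap k n) :
  scomp x (scomp a b) = scomp (scomp x a) b.
Proof. by apply: val_inj; apply/ffunP=> i; rewrite /= !ffunE. Qed.

Definition Delta n : sset :=
  @SSet (fun m => smap m n) (fun m k a x => scomp x a)
    (fun m x => Delta_id x) (fun l m k a b x => Delta_comp a b x).

(** [DeltaS n c] is the simplex Delta(c_0, ..., c_m) of the n-simplex. *)
Definition DeltaS n (c : seq nat) : simplex (Delta n) :=
  @Simplex (Delta n) _ (seq_smap n c).

Definition subsset (X : sset) (A : forall n, pred (X n)) : Prop :=
  forall m n (a : smap m n) (x : X n), A n x -> A m (sact a x).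

Section Quotient.
Variables (X : sset) (A : forall n, pred (X n)) (clA : subsset A).

(** In the quotient X/A the simplices outside A survive, and those of A are
    collapsed to [None]. *)
Definition quot_cell n : eqType := option {x : X n | ~~ A x}.

Definition quot_class n (x : X n) : quot_cell n := insub x.

Definition quot_act m n (a : smap m n) (o : quot_cell n) : quot_cell m :=
  obind (fun x => quot_class (sact a (val x))) o.

Lemma quot_id n (o : quot_cell n) : quot_act (sid n) o = o.
Proof. by case: o => [x|] //=; rewrite sact_id /quot_class valK. Qed.

Lemma quot_comp l m n (a : smap m n) (b : smap l m) (o : quot_cell n) :
  quot_act (scomp a b) o = quot_act b (quot_act a o).
Proof.
case: o => [x|] //=; rewrite sact_comp {2}/quot_class.
case: insubP => [y _ yE|/negPn Ay] /=; first by rewrite yE.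
by rewrite /quot_class insubF // (clA b Ay).
Qed.

Definition quot : psset := @PSSet (SSet quot_id quot_comp) None.
End Quotient.

Definition boundary n m (x : Delta n m) : bool :=
  ~~ [forall j, exists i, x i == j].

Lemma boundary_subsset n : subsset (@boundary n).
Proof.
move=> m k a x; rewrite /boundary; apply: contra => /forallP sx.
apply/forallP=> j; have /existsP[i /eqP <-] := sx j.
by apply/existsP; exists (a i); rewrite /= ffunE.
Qed.

Definition simplicial_interval : psset :=
  @PSSet (Delta 1) (seq_smap 1 [:: 0%N]).

Definition simplicial_circle : psset := quot (boundary_subsset (n := 1)).

Section Cochains.
Variables (F : comPzRingType) (X : psset).

(** The elements of the dual of N_*(X)/N_*(pt): functions on simplices
    vanishing on degenerate simplices and on the base point (hence on all the
    simplices of the base point). All degrees are put together: a homogeneous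
    cochain of degree n is one supported on the n-simplices. *)
Definition rcochain_pred : {pred simplex X -> F^o} :=
  fun f => `[< (forall x, degenerate x -> f x = 0) /\
               f (Simplex (basept X)) = 0 >].

Lemma rcochain_submod_closed : submod_closed rcochain_pred.
Proof.
split=> [|k f g /asboolP[f0 f1] /asboolP[g0 g1]]; apply/asboolP; split => //.
  move=> x dx; rewrite -[LHS]/(k *: f x + g x).
  by rewrite f0 // g0 // scaler0 addr0.
by rewrite -[LHS]/(k *: f _ + g _) f1 g1 scaler0 addr0.
Qed.

HB.instance Definition _ :=
  GRing.isSubmodClosed.Build F (simplex X -> F^o) rcochain_pred
    rcochain_submod_closed.

Record rcochain := RCochain {
  rcochain_fun :> simplex X -> F^o;
  rcochainP : rcochain_fun \in rcochain_pred
}.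

HB.instance Definition _ := [isSub for rcochain_fun].
HB.instance Definition _ := [Choice of rcochain by <:].
HB.instance Definition _ := [SubChoice_isSubLmodule of rcochain by <:].

Lemma rcochain_degenerate (f : rcochain) x : degenerate x -> f x = 0.
Proof. by case: f => f /= /asboolP[f0 _] /f0. Qed.

Lemma rcochain_base (f : rcochain) : f (Simplex (basept X)) = 0.
Proof. by case: f => f /= /asboolP[]. Qed.

Definition homogeneous (p : nat) (f : rcochain) : Prop :=
  forall x, sdim x != p -> f x = 0.

Definition dual_fun (x : simplex X) : simplex X -> F^o := fun y => (y == x)%:R.

Lemma dual_subproof x : ~ degenerate x -> x != Simplex (basept X) ->
  dual_fun x \in rcochain_pred.
Proof.
move=> ndx nbx; apply/asboolP; split => [y dy|]; rewrite /dual_fun.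
  by case: eqVneq => // yx; case: ndx; rewrite -yx.
by rewrite eq_sym (negPf nbx).
Qed.

Definition dual x ndx nbx : rcochain := RCochain (@dual_subproof x ndx nbx).

End Cochains.

(** Delta(0,1) and Delta(1) in the interval, and the class of Delta(0,1) in
    the circle. *)
Definition edge : simplex simplicial_interval := DeltaS 1 [:: 0; 1]%N.
Definition vertex1 : simplex simplicial_interval := DeltaS 1 [:: 1]%N.
Definition loop : simplex simplicial_circle :=
  @Simplex simplicial_circle _ (quot_class (@boundary 1) (tagged edge)).

Lemma seq_smapE n c (i : 'I_(size c).-1.+1) : sorted leq c ->
  all (fun x => x <= n)%N c -> seq_smap n c i = inord (nth 0%N c i).
Proof.
case: c i => [|x c] i; first by rewrite /seq_smap /insubd; case: insubP => //=
  [a _ ->|_]; rewrite ffunE //= ?nth_nil // => _ _; apply: val_inj;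
  rewrite /= inordK.
move=> sc /allP cn; have ub (j : 'I_(size c).+1) : (nth 0 (x :: c) j <= n)%N.
  by apply: cn; rewrite mem_nth.
rewrite /seq_smap val_insubd ifT ?ffunE //.
apply/forallP=> j; apply/forallP=> k; apply/implyP=> jk.
rewrite !ffunE /= !inordK ?ltnS ?ub //.
by apply: (sorted_leq_nth leq_trans leqnn) => //; rewrite inE /= ltn_ord.
Qed.

Lemma edgeE (i : 'I_2) : val ((seq_smap 1 [:: 0; 1]%N : smap 1 1) i) = val i.
Proof.
apply: etrans (congr1 val (@seq_smapE 1 [:: 0; 1]%N i isT isT)) _.
by case: i => [[|[|//]]] ? /=; rewrite inordK.
Qed.

Lemma vertexE (j : 'I_2) (i : 'I_1) :
  ((seq_smap 1 [:: val j] : smap 0 1) i) = j.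
Proof.
apply: etrans (@seq_smapE 1 [:: val j] i isT _) _.
  by rewrite /= andbT -ltnS.
by rewrite (ord1 i); apply/val_inj; rewrite /= inordK.
Qed.

Lemma edge_nondegenerate : ~ degenerate edge.
Proof.
rewrite /degenerate /edge /=; move=> [[|m] [a [y [//= _ E]]]].
have := congr1 (fun z : smap 1 1 => val (z ord_max)) E.
have := congr1 (fun z : smap 1 1 => val (z ord0)) E.
by rewrite /= !edgeE !ffunE (ord1 (a ord0)) (ord1 (a ord_max)) => <-.
Qed.

Lemma edge_base : edge != Simplex (basept simplicial_interval).
Proof. by apply/eqP=> /(congr1 (@sdim _)). Qed.

Lemma vertex1_nondegenerate : ~ degenerate vertex1.
Proof. by move=> [m [a [y []]]]. Qed.

Lemma vertex1_base : vertex1 != Simplex (basept simplicial_interval).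
Proof.
rewrite /vertex1 /DeltaS /Simplex /=; apply/negP.
rewrite eq_Tagged /= => /eqP E.
have /= := congr1 (fun z : smap 0 1 => val (z ord0)) E.
by rewrite (vertexE ord0) (vertexE ord_max).
Qed.

Lemma loop_nondegenerate : ~ degenerate loop.
Proof.
rewrite /degenerate /loop /=; move=> [[|m] [a [y [//= _]]]].
rewrite /quot_class insubT => [|nb].
  rewrite /boundary negbK; apply/forallP=> j; apply/existsP; exists j.
  by apply/eqP/val_inj; rewrite edgeE.
case: y => [[y ny]|] //=; move: ny; rewrite /boundary negbK => /forallP sy.
have /existsP[i0 /eqP e0] := sy ord0; have /existsP[i1 /eqP] := sy ord_max.
by rewrite (ord1 i1) -(ord1 i0) e0 => /(congr1 val).
Qed.

Lemma loop_base : loop != Simplex (basept simplicial_circle).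
Proof. by apply/eqP=> /(congr1 (@sdim _)). Qed.

Definition circle_e (F : comPzRingType) : rcochain F simplicial_circle :=
  dual F loop_nondegenerate loop_base.
Definition cone_e (F : comPzRingType) : rcochain F simplicial_interval :=
  dual F edge_nondegenerate edge_base.
Definition cone_c (F : comPzRingType) : rcochain F simplicial_interval :=
  dual F vertex1_nondegenerate vertex1_base.

Definition adjacent_distinct (T : eqType) (s : seq T) : bool :=
  sorted (fun x y => x != y) s.

(** The quotient by the degenerate tuples is the free module on the
    nondegenerate ones. *)
Record be_gen r d := BEGen {
  be_tuple :> d.+1.-tuple 'S_r;
  _ : adjacent_distinct be_tuple
}.
HB.instance Definition _ r d := [isSub for @be_tuple r d].
HB.instance Definition _ r d := [Finite of be_gen r d by <:].

Definition barratt_eccles (F : comPzRingType) r d := {ffun be_gen r d -> F^o}.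
HB.instance Definition _ F r d := GRing.Lmodule.on (@barratt_eccles F r d).

Definition be_basis F r d (b : be_gen r d) : barratt_eccles F r d :=
  [ffun b' => (b' == b)%:R].

Lemma be_act_subproof r d (s : 'S_r) (w : be_gen r d) :
  adjacent_distinct [tuple of [seq (u * s)%g | u <- w]].
Proof.
rewrite /adjacent_distinct sorted_map; apply: etrans (valP w).
by apply: eq_sorted => u v; rewrite /relpre /= (inj_eq (mulIg s)).
Qed.

(** Composition of permutations is written in diagrammatic order: [(u * s)%g]
    maps k to s (u k). *)
Definition be_act_gen r d (s : 'S_r) (w : be_gen r d) : be_gen r d :=
  BEGen (be_act_subproof s w).

Definition be_act F r d (s : 'S_r) (w : barratt_eccles F r d) :
    barratt_eccles F r d :=
  \sum_(b : be_gen r d) w b *: be_basis F (be_act_gen s b).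

Record surj_gen r d := SurjGen {
  surj_tuple :> (r + d).-tuple 'I_r;
  _ : [forall k, k \in surj_tuple] && adjacent_distinct surj_tuple
}.
HB.instance Definition _ r d := [isSub for @surj_tuple r d].
HB.instance Definition _ r d := [Finite of surj_gen r d by <:].

Definition surjections (F : comPzRingType) r d := {ffun surj_gen r d -> F^o}.
HB.instance Definition _ F r d := GRing.Lmodule.on (@surjections F r d).

(** The class of a sequence, zero when it is not a nondegenerate surjection
    defined on {1, ..., r + d}. *)
Definition surj_class F r d (u : seq 'I_r) : surjections F r d :=
  [ffun v : surj_gen r d => (v == u :> seq _)%:R].

(** The concatenated lines; [used] collects the non-final entries of the lines
    already formed, and [codom w] is the sequence of values of [w]. *)
Fixpoint TR_lines r (used : seq 'I_r) (ws : seq 'S_r) (rs : seq nat) :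
    seq 'I_r :=
  match ws, rs with
  | w :: ws', k :: rs' =>
      let line := take k [seq x <- codom w | x \notin used] in
      line ++ TR_lines (used ++ take k.-1 line) ws' rs'
  | _, _ => [::]
  end.

Definition TR_gen F r d (w : be_gen r d) : surjections F r d :=
  \sum_(rs : d.+1.-tuple 'I_(r + d).+1 |
        all (fun k : 'I_(r + d).+1 => 0 < k)%N rs
        && (sumn [seq val k | k <- rs] == r + d)%N)
    surj_class F d (TR_lines [::] w [seq val k | k <- rs]).

Definition TR F r d (w : barratt_eccles F r d) : surjections F r d :=
  \sum_(b : be_gen r d) w b *: TR_gen F b.

(** Sequences 0 = n_0 <= ... <= n_l = n. *)
Definition cuts l n : seq (seq nat) :=
  [seq [seq val i | i <- tval c] | c <- enum {: l.+1.-tuple 'I_n.+1}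
    & [&& tnth c ord0 == ord0, tnth c ord_max == ord_max
        & sorted leq [seq val i | i <- tval c]]].

Section AW.
Variables (r l : nat) (u : l.-tuple 'I_r) (ns : seq nat).

(** For i : 'I_l the interval is [ns_i, ns_(i+1)], labelled by the i-th value
    of u. *)
Definition lo (i : 'I_l) : nat := nth 0%N ns i.
Definition hi (i : 'I_l) : nat := nth 0%N ns i.+1.

Definition aw_verts (k : 'I_r) : seq nat :=
  flatten [seq iota (lo i) (hi i - lo i).+1 | i <- enum 'I_l & tnth u i == k].

Definition final_interval (i : 'I_l) : bool :=
  [forall j : 'I_l, (i < j)%N ==> (tnth u j != tnth u i)].

Definition interval_length (i : 'I_l) : nat :=
  (hi i - lo i + ~~ final_interval i)%N.

(** The exponent of the sign: positions of the inner intervals plus the Koszul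
    exponent of the stable sorting of the labels. *)
Definition aw_exp : nat :=
  (\sum_(i < l | ~~ final_interval i) hi i
   + \sum_(i < l) \sum_(j < l | (i < j)%N && (tnth u j < tnth u i)%N)
       interval_length i * interval_length j)%N.
End AW.

(** Elements of N_*(X)^{(x) r}, as formal linear combinations (lists of
    weighted tensors) of r-tuples of simplices. They are only ever paired with
    normalized cochains, which vanish on degenerate simplices. *)
Definition tensors (F : comPzRingType) (X : sset) r :=
  seq (F * {ffun 'I_r -> simplex X}).

Definition AW F (X : sset) r l (u : l.-tuple 'I_r) (x : simplex X) :
    tensors F X r :=
  [seq ((-1) ^+ aw_exp u ns, [ffun k => vertices x (aw_verts u ns k)])
    | ns <- cuts l (sdim x)].

Definition cooperation F (X : sset) r d (w : barratt_eccles F r d)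
    (x : simplex X) : tensors F X r :=
  flatten [seq [seq (TR w u * t.1, t.2) | t <- AW F u x]
          | u <- enum {: surj_gen r d}].

(** The pairing <f_1 (x) ... (x) f_r | x_1 (x) ... (x) x_r>. Only the component
    of degree dim x_k of f_k contributes, so that the Koszul sign of moving f_j
    across x_i for i < j has exponent dim x_i * dim x_j. *)
Definition pairing (F : comPzRingType) (X : psset) r
    (f : {ffun 'I_r -> rcochain F X}) (z : tensors F X r) : F :=
  \sum_(t <- z) t.1 *
    ((-1) ^+ (\sum_(i < r) \sum_(j < r | (i < j)%N)
                sdim (t.2 i) * sdim (t.2 j))
     * \prod_(k < r) f k (t.2 k)).

(** The cooperation of degree d sends an n-simplex to tensors of total degree
    n + d, so only components with deg f_1 + ... + deg f_r = n + d contribute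
    at x, and (-1)^(deg w * (deg f_1 + ... + deg f_r)) reads as below. *)
Definition evaluation_fun (F : comPzRingType) (X : psset) r d
    (w : barratt_eccles F r d) (f : {ffun 'I_r -> rcochain F X}) :
    simplex X -> F^o :=
  fun x => (-1) ^+ (d * (sdim x + d)) * pairing f (cooperation w x).

Lemma degenerate_stutter (X : sset) n (x : X n) m (b : smap m n) p :
  (p < m)%N -> b (inord p) = b (inord p.+1) -> degenerate (Simplex (sact b x)).
Proof.
case: m b => // m b; rewrite ltnS => pm bp.
have mono_s : monotone [ffun i : 'I_m.+2 => inord (unbump p i) : 'I_m.+1].
  apply/forallP=> i; apply/forallP=> j; apply/implyP=> ij; rewrite !ffunE.
  have ub (k : 'I_m.+2) : (unbump p k < m.+1)%N.
    by rewrite /unbump; have := ltn_ord k; case: (ltnP p k) => /=; lia.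
  rewrite !inordK ?ub // /unbump.
  by case: (ltnP p i); case: (ltnP p j) => /=; lia.
have mono_d : monotone [ffun i : 'I_m.+1 => inord (bump p.+1 i) : 'I_m.+2].
  apply/forallP=> i; apply/forallP=> j; apply/implyP=> ij; rewrite !ffunE.
  have ub (k : 'I_m.+1) : (bump p.+1 k < m.+2)%N.
    by rewrite /bump; have := ltn_ord k; case: (ltnP p k) => /=; lia.
  rewrite !inordK ?ub // /bump.
  by case: (ltnP p i); case: (ltnP p j) => /=; lia.
exists m, (Smap mono_s), (sact (scomp b (Smap mono_d)) x); split => //=.
rewrite -sact_comp; congr (sact _ x); apply: val_inj; apply/ffunP=> i.
rewrite /= !ffunE; have im := ltn_ord i.
rewrite (_ : val (inord (unbump p i) : 'I_m.+1) = unbump p i); last first.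
  by rewrite /= inordK // /unbump; case: (ltnP p i) => /=; lia.
have [->|ip] := eqVneq i (inord p.+1).
  rewrite -bp; congr (b _); apply: val_inj; rewrite /= !inordK //;
    rewrite /bump /unbump ?ltnSn //=; lia.
congr (b _); apply: val_inj; rewrite /= inordK.
  have {}ip : (i != p.+1 :> nat)
    by apply: contraNneq ip => <-; rewrite inord_val.
  by rewrite /bump /unbump; case: (ltnP p i) => /= ?; lia.
by rewrite /bump /unbump; case: (ltnP p i) => /= ?; lia.
Qed.

Lemma smap_stutter n m (a : smap n m) : (m < n)%N ->
  exists2 j, (j < n)%N & a (inord j) = a (inord j.+1).
Proof.
move=> mn; have [/existsP[j /eqP E]|/existsPn inj_a] :=
  boolP [exists j : 'I_n, a (inord j) == a (inord j.+1)]; first by exists j.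
have: forall j, (j <= n)%N -> (j <= a (inord j))%N.
  elim=> // j IHj jn; apply: leq_ltn_trans (IHj (ltnW jn)) _.
  have := inj_a (Ordinal jn); rewrite -val_eqE /= ltn_neqAle => -> /=.
  by apply: smap_mono; rewrite !inordK // ltnW.
by move/(_ n (leqnn n)); have := ltn_ord (a (inord n)); lia.
Qed.

Lemma cut_interval l n ns j : ns \in cuts l n -> (j < n)%N ->
  exists i : 'I_l, (lo ns i <= j < hi ns i)%N.
Proof.
case/mapP=> c; rewrite mem_filter => /andP[/and3P[/eqP c0 /eqP cl _] _] -> jn.
set ns' := map _ _.
have nE (i : 'I_l.+1) : nth 0%N ns' i = tnth c i.
  by rewrite (nth_map ord0) ?size_tuple // -tnth_nth.
have ex : exists i, (j < nth 0 ns' i)%N.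
  by exists l; have := nE ord_max; rewrite /= cl => ->.
case: (ex_minnP ex) => [[|i]] ji mini.
  by move: ji; have := nE ord0; rewrite /= c0 => ->.
have il : (i < l)%N.
  rewrite -ltnS ltnNge; apply/negP=> li; move: ji.
  by have := mini l; have := nE ord_max; rewrite /= cl => -> /(_ jn); lia.
exists (Ordinal il); rewrite /lo /hi /= ji andbT leqNgt.
by apply/negP=> /mini; rewrite ltnn.
Qed.

Lemma aw_verts_consecutive r l n (u : l.-tuple 'I_r) ns j :
  ns \in cuts l n -> (j < n)%N ->
  exists k p, [/\ (p.+1 < size (aw_verts u ns k))%N,
    nth 0%N (aw_verts u ns k) p = j & nth 0%N (aw_verts u ns k) p.+1 = j.+1].
Proof.
move=> /cut_interval cut_ns jn; have [i /andP[loj jhi]] := cut_ns _ jn.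
exists (tnth u i); rewrite /aw_verts.
have: i \in [seq i' <- enum 'I_l | tnth u i' == tnth u i].
  by rewrite mem_filter eqxx mem_enum.
case/splitPr=> s1 s2; rewrite map_cat flatten_cat /=.
set t1 := flatten _; set t2 := flatten _.
set m := (_ - _)%N; have jm : (j - lo ns i < m)%N by rewrite /m; lia.
have nthE q : (q <= m)%N ->
    nth 0%N (t1 ++ lo ns i :: iota (lo ns i).+1 m ++ t2) (size t1 + q)
    = (lo ns i + q)%N.
  move=> qm; rewrite -[_ :: _]/(iota (lo ns i) m.+1 ++ t2) nth_cat.
  rewrite ifF; last by lia.
  by rewrite addKn nth_cat size_iota ltnS qm nth_iota.
exists (size t1 + (j - lo ns i))%N; split.
- by rewrite -addnS !size_cat /= size_cat size_iota ltn_add2l ltnS ltn_addr.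
- by rewrite nthE ?subnKC // ltnW.
- by rewrite -addnS nthE // addnS subnKC.
Qed.

Lemma aw_degenerate (X : sset) r l (u : l.-tuple 'I_r) (x : simplex X) ns :
  ns \in cuts l (sdim x) -> degenerate x ->
  exists k, degenerate (vertices x (aw_verts u ns k)).
Proof.
case: x => n x; rewrite /sdim /= => cut_ns [m [a [y /= [mn ->]]]].
have [j jn aj] := smap_stutter a mn.
have [k [p [pk pj pj1]]] := aw_verts_consecutive u cut_ns jn.
exists k; rewrite /vertices /= -sact_comp.
apply: (@degenerate_stutter _ _ _ _ _ p); first by rewrite /sdim /=; lia.
rewrite /= !ffunE /seq_smap /insubd; case: insubP => [b _ ->|_] /=.
  by rewrite !ffunE !inordK ?pj ?pj1 //=; lia.
by rewrite !ffunE.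
Qed.

Lemma vertices_base (F : comPzRingType) (X : psset) (f : rcochain F X) c :
  f (vertices (Simplex (basept X)) c) = 0.
Proof.
rewrite /vertices /=; move: (seq_smap _ _); rewrite /sdim /=.
case: (size c).-1 => [|m] a.
  rewrite (_ : a = sid 0) ?sact_id ?rcochain_base //.
  by apply: val_inj; apply/ffunP=> i; rewrite [LHS]ord1 [RHS]ord1.
apply: rcochain_degenerate; apply: (@degenerate_stutter _ _ _ _ _ 0) => //.
by rewrite [LHS]ord1 [RHS]ord1.
Qed.

Lemma pairing_eq0 (F : comPzRingType) (X : psset) r d
    (w : barratt_eccles F r d) (f : {ffun 'I_r -> rcochain F X}) x :
  (forall (u : surj_gen r d) ns, ns \in cuts (r + d) (sdim x) ->
     exists k, f k (vertices x (aw_verts u ns k)) = 0) ->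
  pairing f (cooperation w x) = 0.
Proof.
move=> f0; rewrite /pairing big_seq big1 // => t.
case/flatten_mapP=> u _ /mapP[t' /mapP[ns cut_ns ->] ->] /=.
have [k fk0] := f0 u ns cut_ns.
by rewrite [X in _ * (_ * X)](bigD1 k) //= ffunE fk0 mul0r !mulr0.
Qed.

Lemma evaluation_subproof (F : comPzRingType) (X : psset) r d
    (r_gt0 : (0 < r)%N) (w : barratt_eccles F r d)
    (f : {ffun 'I_r -> rcochain F X}) :
  evaluation_fun w f \in @rcochain_pred F X.
Proof.
apply/asboolP; rewrite /evaluation_fun; split=> [x dx|].
  rewrite pairing_eq0 ?mulr0 // => u ns /(aw_degenerate u)/(_ dx)[k dk].
  by exists k; apply: rcochain_degenerate.
rewrite pairing_eq0 ?mulr0 // => u ns _.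
by exists (Ordinal r_gt0); apply: vertices_base.
Qed.

Definition evaluation (F : comPzRingType) (X : psset) r (r_gt0 : (0 < r)%N) d
    (w : barratt_eccles F r d) (f : {ffun 'I_r -> rcochain F X}) :
    rcochain F X :=
  RCochain (evaluation_subproof r_gt0 w f).

Definition leading r (w : 'S_r) : nat := head 0%N [seq val i | i <- codom w].

(** For s > 0, the sequence (w_0(1), ..., w_d(1)) has to be the sequence of
    values of a (necessarily unique) permutation p in S_s, which forces
    d = s - 1. *)
Definition eps_gen (F : comPzRingType) s r d (w : be_gen r d) : F :=
  if s is 0 then (d == 0)%:R
  else if [pick p : 'S_s | [seq val i | i <- codom p] == map (@leading r) w]
    is Some p then (-1) ^+ odd_perm p else 0.

Definition eps (F : comPzRingType) s r d (w : barratt_eccles F r d) : F :=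
  \sum_(b : be_gen r d) w b * eps_gen F s b.

Definition operation (F : comPzRingType) (X : psset) r :=
  forall d, barratt_eccles F r d -> {ffun 'I_r -> rcochain F X} -> rcochain F X.

Definition multilinear F X r (mu : operation F X r) : Prop :=
  (forall d f, linear (fun w => mu d w f)) /\
  (forall d w f k, linear (fun g : rcochain F X =>
     mu d w [ffun i => if i == k then g else f i])).

(** (s . w)(f_1, ..., f_r) = +/- w(f_s(1), ..., f_s(r)), with the Koszul sign of
    the permutation of f_1, ..., f_r. *)
Definition equivariant F X r (mu : operation F X r) : Prop :=
  forall d w (s : 'S_r) (p : 'I_r -> nat) (f : {ffun 'I_r -> rcochain F X}),
    (forall k, homogeneous (p k) (f k)) ->
    mu d (be_act s w) f =
    (-1) ^+ (\sum_(i < r) \sum_(j < r | (i < j)%N && (s j < s i)%N)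
               p (s i) * p (s j))
    *: mu d w [ffun k => f (s k)].

Definition cone_equations F r (mu : operation F simplicial_interval r) : Prop :=
  [/\ forall d (w : barratt_eccles F r d),
        mu d w [ffun=> cone_e F]
        = ((-1) ^+ (r * (r - 1))./2 * eps r w) *: cone_e F,
      forall s, (0 < s < r)%N -> forall d (w : barratt_eccles F r d),
        mu d w [ffun k : 'I_r => if (k < s)%N then cone_e F else cone_c F]
        = ((-1) ^+ (s * (s - 1))./2 * eps s w) *: cone_e F
    & forall d (w : barratt_eccles F r d),
        mu d w [ffun=> cone_c F]
        = ((-1) ^+ (0 * (0 - 1))./2 * eps 0 w) *: cone_c F].

(* Main.v *)
Require Import Defs.
From mathcomp Require Import all_boot all_order all_fingroup all_algebra.
From mathcomp Require Import boolp zify.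

(** The value of an evaluation product at a simplex x is a sum of terms indexed
    by a surjection u occurring in TR(w) and a subdivision of [0, dim x]. On the
    edge of the interval a subdivision amounts to the index p of the one piece
    of positive length: the pieces before it are the vertex 0, those after it
    the vertex 1. So C_(k) consists of as many 0's as the label k has
    occurrences among the first p + 1 entries of u, followed by as many 1's as
    it has occurrences among the entries from index p on
    ([aw_verts_step_cut]). A factor e selects the sequence (0, 1) and a factor c
    the sequence (1); hence in w(e, ..., e, c, ..., c), with s factors e, a term
    survives exactly when the first p + 1 entries of u are a permutation of the
    labels of the factors e and the entries from p on are a permutation of all
    labels ([cut_compatible]). Counting entries gives p = d and s = d + 1.

    In such a u each of the first d entries occurs again later. In a sequence
    produced by TR a non-final entry of a line never occurs again, so that the
    first d lines have length one ([TR_lines_recurrent]), and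
        u = (w_0(1), ..., w_(d-1)(1), w_d(1), ..., w_d(r))
    appears with coefficient one ([TR_gen_unit_lines]). The condition on its
    first entries is then that (w_0(1), ..., w_d(1)) be a permutation of
    (1, ..., s), as in the definition of epsilon_s. As for signs, inner
    intervals end at 0, and the intervals of odd length are the first s ones, so
    that the AW sign is (-1) to the number of inversions of this permutation,
    i.e. its signature ([odd_perm_inversions], [cut_compatible_sign]); the
    pairing with s simplices of dimension one gives (-1)^(s(s-1)/2), and the sign
    (-1)^(d(d+1)) is trivial ([eval_gen_edge]).

    At the vertex 1 a factor e gives zero, and w(c, ..., c) only retains
    the surjections without repetitions, which forces d = 0
    ([eval_gen_vertex1]). A cochain on the interval is determined by its values
    at these two simplices. The circle has only one nondegenerate simplex
    besides the base point, where its evaluation products have the same terms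
    as those of the interval on the edge ([evaluation_circle]).

    The equations characterize the products since e and c generate the cochains
    of the interval: multilinearity reduces to factors equal to e or c, and
    equivariance allows the factors e to be moved in front
    ([cone_operation_unique]). Equivariance of the evaluation products
    themselves holds because s acts on TR(w) by relabelling the surjections:
    this permutes the C_(k), and the change in the Koszul sign of the shuffle of
    intervals is the Koszul sign of the permutation of the C_(k)
    ([odd_koszul_relabel]). *)

Set Implicit Arguments.
Unset Strict Implicit.
Unset Printing Implicit Defensive.

Import GRing.Theory Num.Theory.
Local Open Scope ring_scope.

(** * Signs *)

(** Here [u i] is the label of the i-th interval and [L i] its length. For
    i < j the Koszul exponents before and after relabelling both contain
    L i * L j or both omit it, unless s inverts the two labels. Collected by
    labels, the differences form the exponent of the permutation s of blocks
    whose degrees are the total lengths. *)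
Lemma odd_koszul_relabel l r (u : 'I_l -> 'I_r) (L : 'I_l -> nat) (s : 'S_r) :
  odd (\sum_(i < l) \sum_(j < l | (i < j)%N && (s (u j) < s (u i))%N) L i * L j
     + \sum_(i < l) \sum_(j < l | (i < j)%N && (u j < u i)%N) L i * L j)
  = odd (\sum_(a < r) \sum_(b < r | (a < b)%N && (s b < s a)%N)
       (\sum_(i < l | u i == a) L i) * (\sum_(j < l | u j == b) L j)).
Proof.
pose inv i j := ((u i < u j) && (s (u j) < s (u i)))%N.
have -> : (\sum_(a < r) \sum_(b < r | (a < b) && (s b < s a))
     (\sum_(i < l | u i == a) L i) * (\sum_(j < l | u j == b) L j)
   = \sum_(i < l) \sum_(j < l) inv i j * (L i * L j))%N.
  rewrite [RHS](partition_big u predT) //=; apply: eq_bigr => a _.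
  rewrite [RHS]exchange_big /= [RHS](partition_big u predT) //= big_mkcond /=.
  apply: eq_bigr => b _; rewrite exchange_big /=; case: ifP => ab; last first.
    rewrite big1 // => i /eqP ia; rewrite big1 // => j /eqP jb.
    by rewrite /inv ia jb ab.
  rewrite big_distrl /=; apply: eq_bigr => i /eqP ia; rewrite big_distrr /=.
  by apply: eq_bigr => j /eqP jb; rewrite /inv ia jb ab mul1n.
have -> : (\sum_(i < l) \sum_(j < l) inv i j * (L i * L j)
   = \sum_(i < l) \sum_(j < l | i < j) (inv i j + inv j i) * (L i * L j))%N.
  transitivity (\sum_(i < l) \sum_(j < l | i < j) inv i j * (L i * L j)
    + \sum_(i < l) \sum_(j < l | i < j) inv j i * (L i * L j))%N.
    rewrite [X in (_ + X)%N](exchange_big_dep predT) //= -big_split /=.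
    apply: eq_bigr => i _; rewrite (bigID (fun j : 'I_l => i < j)%N) /=.
    congr (_ + _)%N; rewrite big_mkcond [RHS]big_mkcond /=.
    apply: eq_bigr => j _; rewrite [(L j * _)%N]mulnC -leqNgt leq_eqVlt.
    case: (ltnP j i) => //= _; first by rewrite orbT.
    by rewrite orbF; case: eqP => // /val_inj ->; rewrite /inv ltnn.
  rewrite -big_split; apply: eq_bigr => i _; rewrite -big_split.
  by apply: eq_bigr => j _; rewrite mulnDl.
rewrite -big_split /=.
rewrite !(big_morph odd oddD (erefl : odd 0 = false)); apply: eq_bigr => i _.
rewrite 2!big_mkcondr -big_split /=.
(* It remains to compare the parities of the coefficients of L i * L j. *)
rewrite !(big_morph odd oddD (erefl : odd 0 = false)); apply: eq_bigr => j _.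
have inj_s : (s (u j) == s (u i) :> nat) = (u j == u i :> nat).
  by rewrite !val_eqE (inj_eq perm_inj).
rewrite /inv; move: inj_s.
move: (L i * L j)%N (val _) (val _) (val _) (val _) => m a b a' b'.
case: (ltngtP a' b') => //=; case: (ltngtP a b) => //= *; lia.
Qed.

(** Twice this sum is the square of the sum of D minus the sum of the squares,
    which does not depend on the order of the entries. *)
Lemma sum_pairs_perm r (s : 'S_r) (D : 'I_r -> nat) :
  (\sum_(i < r) \sum_(j < r | i < j) D (s i) * D (s j)
   = \sum_(i < r) \sum_(j < r | i < j) D i * D j)%N.
Proof.
have sq (E : 'I_r -> nat) : ((\sum_(i < r) E i) * (\sum_(i < r) E i)
    = \sum_(i < r) E i * E i
      + 2 * \sum_(i < r) \sum_(j < r | i < j) E i * E j)%N.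
  rewrite big_distrl /= mul2n -addnn {1}(exchange_big_dep predT) //=.
  rewrite -!big_split; apply: eq_bigr => i _ /=.
  rewrite big_distrr /= (bigD1 i) //=; congr (_ + _)%N.
  rewrite (bigID (fun j : 'I_r => j < i)%N) /=; congr (_ + _)%N.
    apply: eq_big => [j|j _]; last by rewrite mulnC.
    by rewrite -val_eqE /=; lia.
  by apply: eq_bigl => j; rewrite -val_eqE /=; lia.
have := sq (D \o s); have := sq D; rewrite /comp /=.
have sE (E : 'I_r -> nat) : (\sum_i E (s i) = \sum_i E i)%N.
  by rewrite [RHS](reindex_inj (@perm_inj _ s)).
rewrite (sE D) (sE (fun i => D i * D i)%N) => -> H; apply/eqP.
by rewrite -(eqn_pmul2l (isT : 0 < 2)%N) -(eqn_add2l (\sum_i D i * D i)%N) -H.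
Qed.

(** The determinant of the Vandermonde matrix of (s 0, ..., s (n-1)) is the
    signature of s times a positive integer. By the product formula its sign
    is also (-1) to the number of inversions. *)
Lemma odd_perm_inversions n (s : 'S_n) :
  odd_perm s = odd (\sum_(i < n) \sum_(j < n | (i < j)%N) (s j < s i)%N).
Proof.
pose V (t : 'S_n) : 'M[int]_n := Vandermonde n (\row_i (val (t i))%:Z).
have sgV (t : 'S_n) : Num.sg (\det (V t))
    = (-1) ^+ (\sum_(i < n) \sum_(j < n | (i < j)%N) (t j < t i)%N).
  rewrite det_Vandermonde (big_morph Num.sg (@sgrM _) (@sgr1 _)).
  rewrite -prodrXr; apply: eq_bigr => i _.
  rewrite (big_morph Num.sg (@sgrM _) (@sgr1 _)) -prodrXr.
  apply: eq_bigr => j ij; rewrite !mxE.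
  case: (ltngtP (t j) (t i)) => [ji|ji|/val_inj/perm_inj ji].
  - by rewrite ltr0_sg // subr_lt0 ltz_nat.
  - by rewrite gtr0_sg // subr_gt0 ltz_nat.
  - by rewrite ji ltnn in ij.
(* The matrix of s arises from that of the identity by permuting columns. *)
have VE : V s = V 1%g *m perm_mx s^-1.
  by apply/matrixP=> i j; rewrite -col_permE !mxE perm1.
have := congr1 (fun M => Num.sg (\det M)) VE.
rewrite det_mulmx det_perm odd_permV sgrM !sgV.
have -> : (\sum_(i < n) \sum_(j < n | i < j)
    ((1%g : 'S_n) j < (1%g : 'S_n) i) = 0)%N.
  rewrite big1 // => i _; rewrite big1 // => j ij.
  by rewrite !perm1 ltnNge ltnW.
rewrite mul1r -[(-1) ^+ (\sum_(i < n) _)]signr_odd.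
rewrite -[(-1) ^+ perm.odd_perm s]/((-1) ^+ _).
by case: (odd _); case: (perm.odd_perm s).
Qed.

(** * Expansion of the evaluation products; multilinearity *)

Definition aw_term (F : comPzRingType) (X : psset) r l
    (f : {ffun 'I_r -> rcochain F X}) (x : simplex X)
    (u : l.-tuple 'I_r) (ns : seq nat) : F :=
  (-1) ^+ aw_exp u ns *
  ((-1) ^+ (\sum_(i < r) \sum_(j < r | (i < j)%N)
      sdim (vertices x (aw_verts u ns i)) * sdim (vertices x (aw_verts u ns j)))
   * \prod_(k < r) f k (vertices x (aw_verts u ns k))).

(** By linearity in the operad only basis tuples have to be evaluated
    ([evaluation_funE]). *)
Definition eval_gen (F : comPzRingType) (X : psset) r d (b : be_gen r d)
    (f : {ffun 'I_r -> rcochain F X}) (x : simplex X) : F :=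
  (-1) ^+ (d * (sdim x + d)) *
  \sum_(u : surj_gen r d) TR_gen F b u *
    \sum_(ns <- cuts (r + d) (sdim x)) aw_term f x u ns.

Lemma TR_coefE (F : comPzRingType) r d (w : barratt_eccles F r d) u :
  TR w u = \sum_b w b * TR_gen F b u.
Proof.
rewrite /TR.
rewrite (big_morph (fun t : surjections F r d => t u) (id1 := 0) (op1 := +%R)).
- by apply: eq_bigr => b _; rewrite ffunE.
- by move=> t t'; rewrite ffunE.
- by rewrite ffunE.
Qed.

Lemma evaluation_funE (F : comPzRingType) (X : psset) r d
    (w : barratt_eccles F r d) (f : {ffun 'I_r -> rcochain F X}) x :
  evaluation_fun w f x = \sum_b w b * eval_gen b f x.
Proof.
rewrite /evaluation_fun /pairing big_flatten /= big_map big_enum /=.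
under [RHS]eq_bigr do rewrite /eval_gen mulrCA big_distrr /=.
rewrite -big_distrr exchange_big /=; congr (_ * _); apply: eq_bigr => u _.
under [RHS]eq_bigr do rewrite mulrA.
rewrite -big_distrl /= -TR_coefE !big_map big_distrr /=.
apply: eq_bigr => ns _; rewrite /aw_term /= -!mulrA; congr (_ * (_ * (_ * _))).
- congr (_ ^+ _); apply: eq_bigr => i _; apply: eq_bigr => j _.
  by rewrite !ffunE.
- by apply: eq_bigr => k _; rewrite ffunE.
Qed.

Lemma evaluation_multilinear (F : comPzRingType) (X : psset) r
    (r_gt0 : (0 < r)%N) : multilinear (@evaluation F X r r_gt0).
Proof.
split=> [d f a w w'|d w f k a g h]; apply: val_inj; apply/funext => x.
  rewrite -[RHS]/(a * evaluation_fun w f x + evaluation_fun w' f x) /=.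
  rewrite !evaluation_funE big_distrr -big_split /=; apply: eq_bigr => b _.
  by rewrite !ffunE mulrDl; congr (_ + _); exact: esym (mulrA _ _ _).
rewrite -[RHS]/(a * evaluation_fun w _ x + evaluation_fun w _ x) /=.
rewrite !evaluation_funE big_distrr -big_split /=; apply: eq_bigr => b _.
rewrite [a * _]mulrCA -mulrDr; congr (_ * _).
rewrite /eval_gen [a * _]mulrCA -mulrDr.
congr (_ * _); rewrite big_distrr -big_split /=; apply: eq_bigr => u _.
rewrite [a * _]mulrCA -mulrDr; congr (_ * _).
rewrite big_distrr -big_split /=; apply: eq_bigr => ns _.
rewrite /aw_term [a * _]mulrCA -mulrDr; congr (_ * _).
rewrite [a * _]mulrCA -mulrDr; congr (_ * _).
rewrite !(bigD1 (P := predT) k) //= !ffunE eqxx.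
have E (c : rcochain F X) :
    \prod_(i < r | i != k)
      [ffun i0 => if i0 == k then c else f i0] i (vertices x (aw_verts u ns i))
    = \prod_(i < r | i != k) f i (vertices x (aw_verts u ns i)).
  by apply: eq_bigr => i /negPf ik; rewrite ffunE ik.
by rewrite !E mulrA -mulrDl.
Qed.

(** * Equivariance *)

(** The last occurrence of each label is the only final one. *)
Lemma sum_final_interval r l (u : l.-tuple 'I_r) k : k \in u ->
  (\sum_(i < l | tnth u i == k) final_interval u i = 1)%N.
Proof.
case/tnthP=> j0 j0k; pose P i := tnth u i == k.
have Pj0 : P j0 by rewrite /P j0k.
case: (arg_maxnP (@nat_of_ord l) Pj0) => i /= Pi maxi.
rewrite (bigD1 i) //= [X in nat_of_bool X](_ : _ = true); last first.
  apply/forallP=> j; apply/implyP=> ij; apply: contraL ij => /eqP uji.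
  by rewrite -leqNgt maxi // /P uji.
rewrite big1 // => j /andP[/eqP uj ji]; apply/eqP; rewrite eqb0.
apply/negP=> /forallP/(_ i)/implyP; rewrite uj (eqP Pi) eqxx => ij.
suff /ij: (j < i)%N by [].
by rewrite ltn_neqAle val_eqE ji; apply: maxi; rewrite /P uj.
Qed.

(** The dimension of the simplex of C_(k) is the sum of the lengths of its
    intervals: this is what makes the AW sign comparable with Koszul signs of
    tensors of simplices. *)
Lemma size_aw_verts r l (u : l.-tuple 'I_r) ns k : k \in u ->
  size (aw_verts u ns k)
  = (\sum_(i < l | tnth u i == k) interval_length u ns i).+1.
Proof.
move=> uk; rewrite /aw_verts size_flatten /shape -map_comp sumnE big_map.
rewrite big_filter big_enum_cond /= -addn1 -(sum_final_interval uk) -big_split.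
apply: eq_bigr => i _; rewrite /= size_iota /interval_length.
by case: (final_interval u i); lia.
Qed.

Section Relabel.
Variables (r : nat) (s : 'S_r).

Lemma relabel_subproof d (u : surj_gen r d) :
  [forall k, k \in map_tuple s u] && adjacent_distinct (map_tuple s u).
Proof.
have /andP[/forallP su adj] := valP u; apply/andP; split.
  by apply/forallP=> k; rewrite -(permKV s k) map_f.
rewrite /adjacent_distinct sorted_map; apply: etrans adj.
by apply: eq_sorted => a b; rewrite /relpre /= (inj_eq perm_inj).
Qed.

Definition relabel d (u : surj_gen r d) : surj_gen r d :=
  SurjGen (relabel_subproof u).

Lemma relabel_inj d : injective (@relabel d).
Proof.
move=> u v /(congr1 (fun u => tval (surj_tuple u))) /= /(inj_map perm_inj) uv.
by apply/val_inj/val_inj.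
Qed.

(** The rule of the table reduction only compares entries for equality. *)
Lemma TR_lines_relabel used ws rs :
  TR_lines (map s used) [seq (w * s)%g | w <- ws] rs
  = map s (TR_lines used ws rs).
Proof.
elim: ws used rs => [|w ws IHws] used [|k rs] //=.
have -> : [seq x <- codom (w * s)%g | x \notin map s used]
        = map s [seq x <- codom w | x \notin used].
  rewrite -[codom (w * s)%g](_ : map s (codom w) = _); last first.
    by rewrite -map_comp; apply: eq_map => i; rewrite /= permM.
  by rewrite filter_map; congr map; apply: eq_filter => x;
    rewrite /= (mem_map perm_inj).
by rewrite -!map_take -map_cat IHws map_cat.
Qed.

Lemma TR_gen_relabel F d (b : be_gen r d) u :
  TR_gen F (be_act_gen s b) (relabel u) = TR_gen F b u.
Proof.
rewrite /TR_gen !sum_ffunE; apply: eq_bigr => rs _; rewrite !ffunE.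
by rewrite -[X in TR_lines X]/(map s [::]) TR_lines_relabel
  (inj_eq (inj_map perm_inj)).
Qed.

Section Tuple.
Variables (l : nat) (u : l.-tuple 'I_r) (ns : seq nat).

Lemma aw_verts_relabel k :
  aw_verts (map_tuple s u) ns (s k) = aw_verts u ns k.
Proof.
rewrite /aw_verts; congr (flatten (map _ _)); apply: eq_filter => i.
by rewrite tnth_map (inj_eq perm_inj).
Qed.

Lemma final_interval_relabel i :
  final_interval (map_tuple s u) i = final_interval u i.
Proof.
by apply: eq_forallb => j; rewrite !tnth_map (inj_eq perm_inj).
Qed.

Lemma odd_aw_exp_relabel : (forall k, k \in u) ->
  odd (aw_exp (map_tuple s u) ns)
  = odd (aw_exp u ns)
    (+) odd (\sum_(i < r) \sum_(j < r | (i < j)%N && (s j < s i)%N)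
          (size (aw_verts u ns i)).-1 * (size (aw_verts u ns j)).-1).
Proof.
move=> su.
under [X in _ = _ (+) odd X]eq_bigr => i _ do
  under eq_bigr => j _ do rewrite !size_aw_verts //=.
rewrite -odd_koszul_relabel /aw_exp !oddD.
under eq_bigl do rewrite final_interval_relabel.
rewrite -!addbA; congr (_ (+) _); rewrite addbCA addbb addbF; congr odd.
apply: eq_bigr => i _; apply: eq_big => [j|j _]; first by rewrite !tnth_map.
by rewrite /interval_length !final_interval_relabel.
Qed.
End Tuple.

Lemma be_act_gen_inj d : injective (@be_act_gen r d s).
Proof.
move=> b c /(congr1 (fun u => tval (be_tuple u))) /= /(inj_map (mulIg s)) bc.
by apply/val_inj/val_inj.
Qed.

Lemma be_actE F d (w : barratt_eccles F r d) b :
  be_act s w (be_act_gen s b) = w b.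
Proof.
rewrite /be_act sum_ffunE (bigD1 b) //= !ffunE eqxx big1 => [|c cb].
  by rewrite addr0 -[LHS]/(_ * _) mulr1.
rewrite !ffunE (inj_eq (@be_act_gen_inj d)) eq_sym (negPf cb).
by rewrite -[LHS]/(_ * _) mulr0.
Qed.

Variables (F : comPzRingType) (X : psset).

Lemma aw_term_relabel p (f : {ffun 'I_r -> rcochain F X}) x d
    (u : surj_gen r d) ns :
  (forall k, homogeneous (p k) (f k)) ->
  aw_term f x (relabel u) ns
  = (-1) ^+ (\sum_(i < r) \sum_(j < r | (i < j)%N && (s j < s i)%N)
               p (s i) * p (s j)) * aw_term [ffun k => f (s k)] x u ns.
Proof.
move=> hom_f; rewrite /aw_term.
have prodE : \prod_(k < r) f k (vertices x (aw_verts (relabel u) ns k))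
    = \prod_(k < r) [ffun k => f (s k)] k (vertices x (aw_verts u ns k)).
  rewrite (reindex_inj (@perm_inj _ s)); apply: eq_bigr => k _.
  by rewrite ffunE aw_verts_relabel.
rewrite prodE.
(* The degrees p are those of the simplices, unless the product vanishes. *)
have [/forallP dimE|] := boolP [forall k,
    sdim (vertices x (aw_verts u ns k)) == p (s k)]; last first.
  rewrite negb_forall => /existsP[k dk]; have -> : \prod_(k < r)
      [ffun k0 => f (s k0)] k (vertices x (aw_verts u ns k)) = 0.
    by rewrite (bigD1 k) //= ffunE (hom_f (s k)) // mul0r.
  by rewrite !mulr0.
have su k : k \in tval u by have /andP[/forallP] := valP u.
rewrite !mulrA; congr (_ * _).
have -> : (\sum_(i < r) \sum_(j < r | (i < j)%N)
    sdim (vertices x (aw_verts (relabel u) ns i)) *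
    sdim (vertices x (aw_verts (relabel u) ns j))
  = \sum_(i < r) \sum_(j < r | (i < j)%N)
    sdim (vertices x (aw_verts u ns i)) *
    sdim (vertices x (aw_verts u ns j)))%N.
  rewrite -(sum_pairs_perm s); apply: eq_bigr => i _; apply: eq_bigr => j _.
  by rewrite !aw_verts_relabel.
congr (_ * _); rewrite -exprD -signr_odd odd_aw_exp_relabel //.
rewrite -[in RHS]signr_odd.
congr (_ ^+ nat_of_bool _); rewrite oddD addbC; congr (odd _ (+) _).
apply: eq_bigr => i _; apply: eq_bigr => j _.
by rewrite -(eqP (dimE i)) -(eqP (dimE j)).
Qed.
End Relabel.

Lemma evaluation_equivariant (F : comPzRingType) (X : psset) r
    (r_gt0 : (0 < r)%N) : equivariant (@evaluation F X r r_gt0).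
Proof.
move=> d w s p f hom_f; apply: val_inj; apply/funext => x.
rewrite -[RHS]/(_ * evaluation_fun w _ x) /= !evaluation_funE big_distrr /=.
rewrite (reindex_inj (@be_act_gen_inj _ s d)) /=; apply: eq_bigr => b _.
rewrite be_actE [RHS]mulrCA; congr (_ * _).
rewrite /eval_gen [RHS]mulrCA; congr (_ * _).
rewrite (reindex_inj (@relabel_inj _ s d)) /= big_distrr /=.
apply: eq_bigr => u _.
rewrite TR_gen_relabel [RHS]mulrCA; congr (_ * _).
rewrite big_distrr; apply: eq_bigr => ns _.
by rewrite (aw_term_relabel s x u ns hom_f).
Qed.

(** * Simplices of the interval and of the circle *)

Lemma edge_cellE : tagged edge = sid 1.
Proof. by apply/val_inj/ffunP=> i; apply/val_inj; rewrite edgeE ffunE. Qed.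

Lemma edge_sid : edge = Simplex (X := simplicial_interval) (sid 1 : Delta 1 1).
Proof. by rewrite -edge_cellE. Qed.

(** A monotone map to [1] that is not the identity of [1] stutters if its
    source has positive dimension. *)
Lemma cell_of_edge (X : psset) (x : X 1%N) n (y : smap n 1) : (0 < n)%N ->
  degenerate (Simplex (sact y x)) \/ Simplex (sact y x) = Simplex x.
Proof.
case: n y => [//|[|n]] y _; last first.
  have [j jn yj] := smap_stutter y (isT : 1 < n.+2)%N.
  by left; apply: (@degenerate_stutter _ _ x _ y j).
have [y01|y01] := eqVneq (y (inord 0)) (y (inord 1)).
  by left; apply: (@degenerate_stutter _ _ x _ y 0).
right; rewrite (_ : y = sid 1) ?sact_id //.
have le01 : (y (inord 0) <= y (inord 1))%N by apply: smap_mono; rewrite !inordK.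
have lt01 : (y (inord 0) < y (inord 1))%N.
  by rewrite ltn_neqAle le01 val_eqE y01.
have lt1 := ltn_ord (y (inord 1)).
apply/val_inj/ffunP=> i; rewrite ffunE; apply/val_inj.
have [->|->] : i = inord 0 \/ i = inord 1.
  by case: i => [[|[|//]] ?]; [left|right]; apply/val_inj; rewrite /= inordK.
all: by rewrite /= inordK //=; lia.
Qed.

Lemma interval_cochain_ext (F : comPzRingType)
    (f g : rcochain F simplicial_interval) :
  f edge = g edge -> f vertex1 = g vertex1 -> f = g.
Proof.
move=> fg_edge fg_vertex; apply: val_inj; apply/funext => -[[|n] y] /=.
  case: (ltngtP (y ord0) 1) => [y0|y1|y1].
  - rewrite (_ : existT _ _ _ = Simplex (basept simplicial_interval)).
      by rewrite !rcochain_base.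
    congr (Tagged _); apply/val_inj/ffunP=> i; rewrite (ord1 i).
    rewrite [RHS](vertexE ord0); apply/val_inj => /=.
    by case: (val (y ord0)) y0.
  - by have := ltn_ord (y ord0); rewrite ltnS leqNgt y1.
  - rewrite (_ : existT _ _ _ = vertex1) //.
    congr (Tagged _); apply/val_inj/ffunP=> i; rewrite (ord1 i).
    by rewrite [RHS](vertexE ord_max); apply/val_inj.
rewrite (_ : existT _ _ _ =
    Simplex (X := simplicial_interval)
      (sact (y : smap n.+1 1) (sid 1 : Delta 1 1))); last first.
  by congr (Tagged _); apply/val_inj/ffunP=> i; rewrite /= !ffunE.
case: (@cell_of_edge simplicial_interval (sid 1) _ y (ltn0Sn n)) => [dy|->].
  by rewrite !rcochain_degenerate.
by rewrite -edge_sid.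
Qed.

Definition loop_cell : simplicial_circle 1%N :=
  quot_class (@boundary 1) (sid 1 : Delta 1 1).

Lemma loopE : loop = Simplex loop_cell.
Proof. by rewrite /loop edge_cellE. Qed.

Lemma sid1_nonboundary : ~~ @boundary 1 1 (sid 1).
Proof.
by rewrite negbK; apply/forallP=> j; apply/existsP; exists j; rewrite ffunE.
Qed.

Lemma sact_loop_cell n (y : smap n 1) :
  sact y loop_cell = quot_class (@boundary 1) (y : Delta 1 n).
Proof.
rewrite /= /loop_cell /quot_class.
rewrite (insubT (fun x => ~~ @boundary 1 1 x) sid1_nonboundary) /=.
by congr insub; apply/val_inj/ffunP=> i; rewrite /= !ffunE.
Qed.

Lemma circle_cochain_ext (F : comPzRingType)
    (f g : rcochain F simplicial_circle) : f loop = g loop -> f = g.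
Proof.
move=> fg; apply: val_inj; apply/funext => -[n [[y ny]|]] /=; last first.
  case: n => [|n].
    rewrite -[existT _ _ _]/(Simplex (basept simplicial_circle)).
    by rewrite !rcochain_base.
  by rewrite !rcochain_degenerate //; exists 0%N, (sconst n.+1 ord0), None.
have n_gt0 : (0 < n)%N.
  case: n y ny => //= y; rewrite /boundary negbK => /forallP sy.
  have /existsP[i0 /eqP e0] := sy ord0; have /existsP[i1 /eqP] := sy ord_max.
  by rewrite (ord1 i1) -(ord1 i0) e0 => /(congr1 val).
rewrite (_ : existT _ _ _ = @Simplex simplicial_circle _
    (@sact simplicial_circle n 1 y loop_cell)); last first.
  by congr (Tagged _); rewrite sact_loop_cell /quot_class insubT.
case: (@cell_of_edge simplicial_circle
    loop_cell _ y n_gt0) => [dy|->].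
  by rewrite !rcochain_degenerate.
by rewrite -loopE.
Qed.

Lemma vertices_edge c : vertices edge c = DeltaS 1 c.
Proof.
rewrite edge_sid; congr (Tagged _).
by apply/val_inj/ffunP=> i; rewrite /= !ffunE.
Qed.

(** Simplices outside the boundary keep their identity in the quotient. *)
Lemma loop_cellE n (y : smap n 1) :
  (Simplex (sact y loop_cell) == Simplex loop_cell)
  = (Simplex (X := Delta 1) (y : Delta 1 n)
     == Simplex (X := Delta 1) (sid 1 : Delta 1 1)).
Proof.
rewrite sact_loop_cell; case: (eqVneq n 1%N) y => [->|n1] y; last first.
  by apply/eqP/eqP=> /(congr1 (@sdim _)) /eqP /=; rewrite (negPf n1).
rewrite !eq_Tagged /= /loop_cell /quot_class.
rewrite (insubT (fun x => ~~ @boundary 1 1 x) sid1_nonboundary) /=.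
case: insubP => [z _ zE|yb].
  by rewrite -(inj_eq (@Some_inj _)) -zE /=.
by apply/esym/negbTE; apply: contraNneq yb => ->; apply: sid1_nonboundary.
Qed.

Lemma circle_e_vertices F c :
  circle_e F (vertices loop c) = cone_e F (vertices edge c).
Proof.
rewrite vertices_edge /= /dual_fun edge_sid loopE; congr (nat_of_bool _)%:R.
exact: loop_cellE.
Qed.

(** The terms on both sides are indexed alike and have equal signs, since
    the simplices of the tensors have the same dimensions. *)
Lemma evaluation_circle (F : comPzRingType) r (r_gt0 : (0 < r)%N) d
    (w : barratt_eccles F r d) :
  evaluation r_gt0 w [ffun=> circle_e F] loop
  = evaluation r_gt0 w [ffun=> cone_e F] edge.
Proof.
rewrite /= !evaluation_funE; apply: eq_bigr => b _; congr (_ * (_ * _)).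
apply: eq_bigr => u _; congr (_ * _); apply: eq_bigr => ns _.
congr (_ * (_ * _)); apply: eq_bigr => k _.
by rewrite !ffunE circle_e_vertices.
Qed.

Lemma interval_cochainE (F : comPzRingType)
    (f : rcochain F simplicial_interval) :
  f = (f edge : F) *: cone_e F + ((f vertex1 : F) *: cone_c F + 0).
Proof.
rewrite addr0.
have edge_vertex1 : edge != vertex1 by apply/eqP=> /(congr1 (@sdim _)).
apply: interval_cochain_ext.
  rewrite -[RHS]/(f edge * dual_fun F edge edge
                  + f vertex1 * dual_fun F vertex1 edge).
  by rewrite /dual_fun eqxx (negPf edge_vertex1) mulr1 mulr0 addr0.
rewrite -[RHS]/(f edge * dual_fun F edge vertex1
                + f vertex1 * dual_fun F vertex1 vertex1).
by rewrite /dual_fun eqxx eq_sym (negPf edge_vertex1) mulr1 mulr0 add0r.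
Qed.

(** * Uniqueness of the operations on the cone *)

Definition cone_basis F r (a : pred 'I_r) :
    {ffun 'I_r -> rcochain F simplicial_interval} :=
  [ffun k => if a k then cone_e F else cone_c F].

Lemma linear_ext_cone (F : comPzRingType)
    (g h : rcochain F simplicial_interval -> rcochain F simplicial_interval) :
  linear g -> linear h -> g (cone_e F) = h (cone_e F) ->
  g (cone_c F) = h (cone_c F) -> g =1 h.
Proof.
move=> lg lh ge gc f.
have lin0 : forall k : rcochain F simplicial_interval ->
    rcochain F simplicial_interval, linear k -> k 0 = 0.
  by move=> k lk; have := lk (-1) 0 0; rewrite !scaleN1r oppr0 addr0 addNr.
by rewrite (interval_cochainE f) !lg !lh ge gc (lin0 g) ?(lin0 h).
Qed.

Lemma multilinear_ext_cone (F : comPzRingType) r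
    (mu nu : operation F simplicial_interval r) d w :
  multilinear mu -> multilinear nu ->
  (forall a : pred 'I_r, mu d w (cone_basis F a) = nu d w (cone_basis F a)) ->
  forall f, mu d w f = nu d w f.
Proof.
move=> [_ lmu] [_ lnu] eq_basis.
(* The factors are replaced by e or c one at a time. *)
have step n (f : {ffun _ -> _}) :
    (forall k : 'I_r, (n <= k)%N -> f k = cone_e F \/ f k = cone_c F) ->
    mu d w f = nu d w f.
  elim: n f => [|n IHn] f fk.
    have -> : f = cone_basis F [pred k | f k == cone_e F]; last exact: eq_basis.
    apply/ffunP=> k; rewrite ffunE /=; case: eqP => // fke.
    by case: (fk k).
  case: (ltnP n r) => nr; last first.
    by apply: IHn => k nk; have := ltn_ord k; rewrite ltnNge (leq_trans nr).
  pose k0 := Ordinal nr; pose upd g := [ffun i => if i == k0 then g else f i].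
  have -> : f = upd (f k0).
    by apply/ffunP=> i; rewrite ffunE; case: eqP => // ->.
  apply: (linear_ext_cone (lmu d w f k0) (lnu d w f k0)).
    apply: IHn => k nk; rewrite ffunE; case: eqP => [_|/eqP kk0]; first by left.
    by apply: fk; rewrite ltn_neqAle nk andbT eq_sym.
  apply: IHn => k nk; rewrite ffunE; case: eqP => [_|/eqP kk0]; first by right.
  by apply: fk; rewrite ltn_neqAle nk andbT eq_sym.
by move=> f; apply: (step r) => k; rewrite leqNgt ltn_ord.
Qed.

(** The permutation used to move the factors e in front of the factors c. *)
Lemma sort_pred_perm r (a : pred 'I_r) :
  exists s : 'S_r, forall k, a (s k) = (k < #|a|)%N.
Proof.
have /tuple_permP[s sE] : perm_eq (enum a ++ enum (predC a)) (ord_tuple r).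
  apply: uniq_perm.
  - rewrite cat_uniq !enum_uniq andbT /=; apply/hasPn => x.
    by rewrite !mem_enum.
  - exact: enum_uniq.
  - move=> x; rewrite mem_cat !mem_enum. by rewrite inE /= orbN.
exists s => k.
have -> : s k = nth k (enum a ++ enum (predC a)) k.
  by rewrite sE (nth_map k) ?size_enum_ord // tnth_ord_tuple nth_ord_enum.
rewrite nth_cat -cardE; case: ltnP => ka.
  have := mem_nth k (_ : k < size (enum a))%N; rewrite -cardE mem_enum.
  exact.
have := mem_nth k (_ : k - #|a| < size (enum (predC a)))%N.
rewrite -cardE mem_enum => H; apply/negbTE/H.
by rewrite ltn_subLR // [(_ + _)%N]cardC card_ord.
Qed.

Lemma homogeneous_cone_basis F r (a : pred 'I_r) k :
  homogeneous (a k) (cone_basis F a k).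
Proof.
move=> x; rewrite ffunE; case: (a k) => /= dx; rewrite /dual_fun.
  by case: (x =P edge) dx => // ->.
by case: (x =P vertex1) dx => // ->.
Qed.

Lemma be_act_surj F r d (s : 'S_r) (w : barratt_eccles F r d) :
  exists w', w = be_act s w'.
Proof.
exists (be_act s^-1 w); apply/ffunP=> b.
have bE : b = be_act_gen s (be_act_gen s^-1 b).
  apply/val_inj/val_inj; rewrite /= -map_comp -[LHS]map_id.
  by apply: eq_map => u /=; rewrite -mulgA mulVg mulg1.
by rewrite [in RHS]bE !be_actE.
Qed.

Lemma cone_operation_unique (F : comPzRingType) r
    (mu nu : operation F simplicial_interval r) :
  multilinear mu -> equivariant mu -> cone_equations mu ->
  multilinear nu -> equivariant nu -> cone_equations nu ->
  forall d w f, mu d w f = nu d w f.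
Proof.
move=> lmu emu [mu_r mu_s mu_0] lnu enu [nu_r nu_s nu_0] d w.
apply: multilinear_ext_cone => // a; have [s sa] := sort_pred_perm a.
have [w' ->] := be_act_surj s w.
rewrite (emu _ _ _ _ _ (@homogeneous_cone_basis F r a)).
rewrite (enu _ _ _ _ _ (@homogeneous_cone_basis F r a)); congr (_ *: _).
have -> : [ffun k => cone_basis F a (s k)]
    = [ffun k : 'I_r => if (k < #|a|)%N then cone_e F else cone_c F].
  by apply/ffunP=> k; rewrite !ffunE sa.
have := max_card a; rewrite card_ord leq_eqVlt => /orP[/eqP ar|ar].
  rewrite (_ : finfun _ = [ffun=> cone_e F]) ?mu_r ?nu_r //.
  by apply/ffunP=> k; rewrite !ffunE ar ltn_ord.
have [a0|a0] := posnP #|a|; last by rewrite mu_s ?nu_s ?a0.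
rewrite (_ : finfun _ = [ffun=> cone_c F]) ?mu_0 ?nu_0 //.
by apply/ffunP=> k; rewrite !ffunE a0.
Qed.

(** * Subdivisions of an edge *)

(** The subdivision of [0, 1] into l intervals whose p-th one is [0, 1]. *)
Definition step_cut l p : seq nat := mkseq (fun i => (p < i)%N : nat) l.+1.

Lemma nth_step_cut l p i : (i <= l)%N -> nth 0%N (step_cut l p) i = (p < i)%N.
Proof. by move=> il; rewrite nth_mkseq. Qed.

Lemma cutsP l n ns : reflect
  [/\ size ns = l.+1, all (fun x => x <= n)%N ns, nth 0%N ns 0 = 0%N,
      nth 0%N ns l = n & sorted leq ns] (ns \in cuts l n).
Proof.
apply: (iffP mapP) => [[c]|[sz ub n0 nl srt]].
  rewrite mem_filter => /andP[/and3P[/eqP c0 /eqP cl srt] _] ->.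
  have nE (i : 'I_l.+1) : nth 0%N [seq val i | i <- tval c] i = tnth c i.
    by rewrite (nth_map ord0) ?size_tuple // -tnth_nth.
  split=> //.
  - by rewrite size_map size_tuple.
  - by apply/allP=> _ /mapP[i _ ->]; exact: leq_ord.
  - by rewrite (nE ord0) c0.
  - by rewrite (nE ord_max) cl.
have vE (i : 'I_l.+1) : val (inord (nth 0%N ns i) : 'I_n.+1) = nth 0%N ns i.
  by rewrite /= inordK // ltnS (allP ub) // mem_nth // sz.
exists [tuple inord (nth 0%N ns i) | i < l.+1]; last first.
  apply: (@eq_from_nth _ 0%N); first by rewrite size_map size_tuple.
  move=> i; rewrite sz => il; rewrite (nth_map ord0) ?size_tuple //.
  by rewrite -(tnth_nth ord0 _ (Ordinal il)) tnth_mktuple (vE (Ordinal il)).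
rewrite mem_filter mem_enum andbT; apply/and3P; split.
- by apply/eqP/val_inj; rewrite tnth_mktuple vE.
- by apply/eqP/val_inj; rewrite tnth_mktuple vE.
- rewrite (_ : map _ _ = ns) //.
  apply: (@eq_from_nth _ 0%N); rewrite size_map size_tuple //.
  move=> i il; rewrite (nth_map ord0) ?size_tuple //.
  by rewrite -(tnth_nth ord0 _ (Ordinal il)) tnth_mktuple (vE (Ordinal il)).
Qed.

Lemma cuts_uniq l n : uniq (cuts l n).
Proof.
rewrite map_inj_uniq; first by rewrite filter_uniq ?enum_uniq.
by move=> c c' /(inj_map val_inj) cc'; apply: val_inj.
Qed.

Lemma mem_cuts1 l ns :
  (ns \in cuts l 1) = (ns \in [seq step_cut l p | p : 'I_l <- enum 'I_l]).
Proof.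
apply/idP/idP => [cut_ns|/mapP[p _ ->]].
  have [p /andP[lop hip]] := cut_interval cut_ns (ltn0Sn 0).
  have /cutsP[sz ub _ _ srt] := cut_ns.
  apply/mapP; exists p; rewrite ?mem_enum //.
  apply: (@eq_from_nth _ 0%N); first by rewrite sz size_mkseq.
  move=> i; rewrite sz ltnS => il; rewrite nth_step_cut //.
  have mono a b : (a <= b)%N -> (b <= l)%N -> (nth 0 ns a <= nth 0 ns b)%N.
    move=> ab bl; apply: (sorted_leq_nth leq_trans leqnn) => //;
      by rewrite inE sz ltnS // (leq_trans ab).
  have ub1 : (nth 0 ns i <= 1)%N by apply: (allP ub); rewrite mem_nth // sz.
  rewrite /lo /hi in lop hip; case: ltnP => pi.
    by have := mono _ _ pi il; lia.
  by have := mono _ _ pi (ltnW (ltn_ord p)); lia.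
apply/cutsP; split.
- by rewrite size_mkseq.
- by apply/allP=> _ /mapP[i _ ->]; case: ltnP.
- by rewrite nth_step_cut.
- by rewrite nth_step_cut // ltn_ord.
- apply/(sortedP 0%N) => i; rewrite size_mkseq ltnS => il.
  by rewrite !nth_step_cut //; lia.
Qed.

Lemma sum_cuts1 (V : nmodType) l (G : seq nat -> V) :
  \sum_(ns <- cuts l 1) G ns = \sum_(p < l) G (step_cut l p).
Proof.
rewrite (perm_big _ (uniq_perm (cuts_uniq l 1) _ (@mem_cuts1 l))) /=.
  by rewrite big_map big_enum.
rewrite map_inj_in_uniq ?enum_uniq // => p q _ _ pq; apply: val_inj => /=.
have pl := ltn_ord p; have ql := ltn_ord q.
have := congr1 (fun ns => nth 0%N ns p.+1) pq.
have := congr1 (fun ns => nth 0%N ns q.+1) pq.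
by rewrite !nth_step_cut //; lia.
Qed.

(** A stretch of pieces reduced to one point contributes that point once per
    piece carrying the label. *)
Lemma flatten_constant_intervals (I : Type) (P : pred I) (c : nat)
    (f g : I -> nat) (s : seq I) :
  all (fun i => (f i == c) && (g i == c)) s ->
  flatten [seq iota (f i) (g i - f i).+1 | i <- s & P i] = nseq (count P s) c.
Proof.
elim: s => //= i s IHs /andP[/andP[/eqP fi /eqP gi] /IHs].
case: (P i) => //= ->.
by rewrite fi gi subnn.
Qed.

(** The piece of index p contributes both a 0 and a 1, which is why its entry
    of u is counted in the two segments. *)
Lemma aw_verts_step_cut r l (u : l.-tuple 'I_r) (p : 'I_l) k :
  aw_verts u (step_cut l p) k
  = nseq (count_mem k (take p.+1 u)) 0%N ++ nseq (count_mem k (drop p u)) 1%N.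
Proof.
have pl := ltn_ord p; pose P i := tnth u i == k.
have enumE : enum 'I_l = take p (enum 'I_l) ++ p :: drop p.+1 (enum 'I_l).
  rewrite -[LHS](cat_take_drop p) (drop_nth p) ?size_enum_ord //.
  by rewrite nth_ord_enum.
have countE :
    count_mem k (take p.+1 u) = (count P (take p (enum 'I_l)) + P p)%N.
  rewrite -(map_tnth_enum u) -map_take count_map (take_nth p) ?size_enum_ord //.
  by rewrite -cats1 count_cat /= addn0 nth_ord_enum.
have countE' :
    count_mem k (drop p u) = (P p + count P (drop p.+1 (enum 'I_l)))%N.
  rewrite -(map_tnth_enum u) -map_drop count_map (drop_nth p) ?size_enum_ord //.
  by rewrite /= nth_ord_enum.
have inE1 i : i \in take p (enum 'I_l) -> (i < p)%N.
  move=> ip; have := map_f val ip; rewrite map_take val_enum_ord.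
  by rewrite take_iota mem_iota /=; lia.
have inE2 i : i \in drop p.+1 (enum 'I_l) -> (p < i)%N.
  move=> ip; have := map_f val ip; rewrite map_drop val_enum_ord.
  by rewrite drop_iota mem_iota /=; lia.
move: enumE countE countE' inE1 inE2.
move: (take p (enum _)) (drop p.+1 (enum _)) => A B enumE -> -> inE1 inE2.
rewrite /aw_verts enumE -cat1s !filter_cat !map_cat !flatten_cat.
rewrite (@flatten_constant_intervals _ P 0 _ _ A); last first.
  apply/allP=> i /inE1 ip; have il := ltn_ord i.
  by rewrite /lo /hi !nth_step_cut //; lia.
rewrite (@flatten_constant_intervals _ P 1 _ _ B); last first.
  apply/allP=> i /inE2 ip; have il := ltn_ord i.
  by rewrite /lo /hi !nth_step_cut //; lia.
rewrite !nseqD -catA; congr (_ ++ _); rewrite catA; congr (_ ++ _).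
rewrite [filter _ _]/= -/(P p); case: (P p) => //=.
by rewrite /lo /hi !nth_step_cut // ?ltnn ?ltnSn // ltnW.
Qed.

Lemma DeltaS_eq_edge a b :
  (DeltaS 1 (nseq a 0%N ++ nseq b 1%N) == edge) = (a == 1%N) && (b == 1%N).
Proof.
apply/eqP/andP => [E|[/eqP-> /eqP->] //].
have := congr1 (@sdim _) E; rewrite /sdim /= size_cat !size_nseq.
case: a b E => [|[|[|a]]] [|[|[|b]]] E //= _; exfalso.
all: move/eqP: E; rewrite eq_Tagged /= => /eqP E.
- have := congr1 (fun z : smap 1 1 => val (z ord0)) E.
  by rewrite /= edgeE /= (@seq_smapE 1 [:: 1; 1]%N ord0) //= inordK.
- have := congr1 (fun z : smap 1 1 => val (z ord_max)) E.
  by rewrite /= edgeE /= (@seq_smapE 1 [:: 0; 0]%N ord_max) //= inordK.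
Qed.

Lemma DeltaS_eq_vertex1 a b :
  (DeltaS 1 (nseq a 0%N ++ nseq b 1%N) == vertex1) = (a == 0%N) && (b == 1%N).
Proof.
apply/eqP/andP => [E|[/eqP-> /eqP->] //].
have := congr1 (@sdim _) E; rewrite /sdim /= size_cat !size_nseq.
case: a b E => [|[|a]] [|[|b]] E //= _; exfalso.
all: move/eqP: E; rewrite eq_Tagged /= => /eqP E.
- have := congr1 (fun z : smap 0 1 => val (z ord0)) E.
  by rewrite /= (vertexE ord_max) (@seq_smapE 1 [::]%N ord0) //= inordK.
- have := congr1 (fun z : smap 0 1 => val (z ord0)) E.
  by rewrite /= (vertexE ord_max) (@seq_smapE 1 [:: 0]%N ord0) //= inordK.
Qed.

(** * The surjections of the table reduction *)

Lemma codom_cons r (w : 'S_r.+1) :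
  codom w = w ord0 :: [seq w (lift ord0 i) | i <- enum 'I_r].
Proof. by rewrite /codom /image_mem enum_ordSl /= -map_comp. Qed.

Lemma leadingE r (w : 'S_r.+1) : leading w = w ord0.
Proof. by rewrite /leading codom_cons. Qed.

Lemma codom_perm_uniq r (w : 'S_r) : uniq (codom w).
Proof. by rewrite map_inj_uniq ?enum_uniq //; apply: perm_inj. Qed.

(** Entries marked as used are filtered out of all later lines. *)
Lemma TR_lines_notin r (used : seq 'I_r) ws rs x :
  x \in used -> x \notin TR_lines used ws rs.
Proof.
elim: ws used rs => [|w ws IHws] used [|k rs] //= xu.
rewrite mem_cat negb_or IHws ?mem_cat ?xu // andbT.
by apply: contraL xu => /mem_take; rewrite mem_filter => /andP[].
Qed.

Lemma TR_lines_rcons r (ws : seq 'S_r.+1) w k :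
  TR_lines [::] (rcons ws w) (rcons (nseq (size ws) 1%N) k)
  = [seq v ord0 | v : 'S_r.+1 <- ws] ++ take k (codom w).
Proof.
elim: ws => [|v ws IHws] /=.
  by rewrite cats0 filter_predT.
by rewrite filter_predT codom_cons /= take0 IHws.
Qed.

(** If a line had length two or more, its first entry would be non-final and
    could not occur again. *)
Lemma TR_lines_recurrent r (ws : seq 'S_r.+1) w rs :
  size rs = (size ws).+1 -> all (leq 1) rs ->
  (forall i, (i < size ws)%N ->
     nth ord0 (TR_lines [::] (rcons ws w) rs) i
       \in drop i.+1 (TR_lines [::] (rcons ws w) rs)) ->
  take (size ws) rs = nseq (size ws) 1%N.
Proof.
elim: ws rs => [|v ws IHws] [|k rs] //= [srs] /andP[k_gt0 rs_gt0].
rewrite filter_predT; case: k k_gt0 => [|[|k]] //= _ rec.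
  congr (_ :: _); apply: IHws => // i iws; have := rec i.+1 iws.
  by rewrite codom_cons /= take0.
(* Now the first line has length at least two. *)
have := rec 0%N isT; have := codom_perm_uniq v.
rewrite codom_cons /= drop0 mem_cat => /andP[vc _] /orP[/mem_take vc'|].
  by rewrite vc' in vc.
by rewrite (negPf (TR_lines_notin _ _ _)) // inE eqxx.
Qed.

Section UnitLines.
Variables (r d : nat) (b : be_gen r.+1 d).

(** The summand of TR(w) with line lengths (1, ..., 1, r). It is the only one
    to contribute on the edge. *)
Definition unit_lines : seq 'I_r.+1 :=
  TR_lines [::] b (rcons (nseq d 1%N) r.+1).

Definition leads : seq 'I_r.+1 := [seq w ord0 | w : 'S_r.+1 <- b].

Let b_rcons : exists ws w, tval b = rcons ws w /\ size ws = d.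
Proof.
have := size_tuple b; case/lastP: (tval b) => [//|ws w].
by rewrite size_rcons => -[sz]; exists ws, w.
Qed.

Lemma size_leads : size leads = d.+1.
Proof. by rewrite size_map size_tuple. Qed.

Lemma unit_linesE : exists ws (w : 'S_r.+1) c,
  [/\ unit_lines = ws ++ w ord0 :: c,
   codom w = w ord0 :: c, leads = rcons ws (w ord0) & size ws = d].
Proof.
have [ws [w [bE sz]]] := b_rcons; rewrite /unit_lines /leads bE map_rcons -sz.
rewrite TR_lines_rcons take_oversize ?size_codom ?card_ord // codom_cons.
by do 3!eexists; split; rewrite ?size_map //; apply: codom_cons.
Qed.

Lemma take_unit_lines : take d.+1 unit_lines = leads.
Proof.
have [ws [w [c [-> _ -> <-]]]] := unit_linesE.
by rewrite -cat_rcons take_size_cat // size_rcons.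
Qed.

Lemma drop_unit_lines : perm_eq (drop d unit_lines) (enum 'I_r.+1).
Proof.
have [ws [w [c [-> wE _ <-]]]] := unit_linesE; rewrite drop_size_cat // -wE.
apply: uniq_perm; rewrite ?codom_perm_uniq ?enum_uniq // => i.
by rewrite mem_enum; apply/codomP; exists (w^-1 i)%g; rewrite permKV.
Qed.

Lemma size_unit_lines : size unit_lines = (r.+1 + d)%N.
Proof.
have [ws [w [c [-> wE _ sz]]]] := unit_linesE; rewrite size_cat -wE.
by rewrite size_codom card_ord sz addnC.
Qed.

(** The last line is all of w_d, which gives surjectivity. Two adjacent equal
    entries would lie both among the leading ones or both in the last line,
    as these two segments share an entry; neither has repetitions. *)
Lemma unit_lines_surjection : uniq leads ->
  exists u : surj_gen r.+1 d, tval u = unit_lines.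
Proof.
move=> ul.
have sz : size unit_lines == (r.+1 + d)%N by rewrite size_unit_lines.
suff P : [forall k, k \in Tuple sz] && adjacent_distinct (Tuple sz).
  by exists (SurjGen P).
apply/andP; split.
  apply/forallP=> k; apply: (@mem_drop d); rewrite (perm_mem drop_unit_lines).
  by rewrite mem_enum.
rewrite /adjacent_distinct /=; have [ws [w [c [-> wE lE _]]]] := unit_linesE.
have: sorted (fun x y => x != y) (rcons ws (w ord0)).
  by apply: pairwise_sorted; rewrite -uniq_pairwise -lE.
have: sorted (fun x y => x != y) (w ord0 :: c).
  by apply: pairwise_sorted; rewrite -uniq_pairwise -wE codom_perm_uniq.
case: ws {lE} => //= y ws; rewrite rcons_path cat_path /= => -> /andP[-> ->].
by [].
Qed.

(** The hypothesis says that the last r entries of u list all the labels, so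
    that each of the first d entries is repeated. By [TR_lines_recurrent] this
    determines the lengths of the first d lines, and then that of the last
    one. *)
Lemma TR_gen_unit_lines F (u : surj_gen r.+1 d) :
  perm_eq (drop d u) (enum 'I_r.+1) ->
  TR_gen F b u = (tval u == unit_lines)%:R.
Proof.
move=> du; have szu := size_tuple u.
have rec i : (i < d)%N -> nth ord0 u i \in drop i.+1 (tval u).
  move=> id; rewrite -[drop i.+1 _](cat_take_drop (d - i.+1)) mem_cat.
  by rewrite drop_drop subnK // [X in _ || X](perm_mem du) mem_enum orbT.
pose rs0 := rcons (nseq d 1%N) r.+1.
have szrs0 : size rs0 = d.+1 by rewrite size_rcons size_nseq.
have rs0_ub i : (nth 0 rs0 i < (r.+1 + d).+1)%N.
  rewrite nth_rcons nth_nseq size_nseq.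
  by case: (ltngtP i d) => _; lia.
have [rsT vrs0] : exists rsT : d.+1.-tuple 'I_(r.+1 + d).+1,
    [seq val k | k <- rsT] = rs0.
  exists [tuple inord (nth 0%N rs0 i) | i < d.+1].
  apply: (@eq_from_nth _ 0%N); rewrite size_map size_tuple ?szrs0 // => i id.
  rewrite (nth_map ord0) ?size_tuple // -(tnth_nth ord0 _ (Ordinal id)).
  by rewrite tnth_mktuple /= inordK.
rewrite /TR_gen sum_ffunE.
rewrite (bigD1 rsT) /=; last first.
  apply/andP; split; last first.
    by rewrite vrs0 /rs0 sumn_rcons sumn_nseq mul1n addnC.
  have : all (leq 1) rs0 by rewrite all_rcons all_nseq leqnn orbT.
  by rewrite -vrs0 all_map.
rewrite ffunE vrs0 big1 ?addr0 // => rs /andP[/andP[rs_gt0 sum_rs] rs_neq].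
rewrite ffunE; case: eqP => // uE; case/eqP: rs_neq.
apply/val_inj/(inj_map val_inj); rewrite [RHS]vrs0.
have [ws [w [bE sz]]] := b_rcons.
have := @TR_lines_recurrent _ ws w [seq val k | k <- tval rs].
rewrite -bE -uE sz size_map size_tuple all_map.
move=> /(_ erefl rs_gt0 rec) takeE.
rewrite -[LHS](cat_take_drop d) takeE /rs0 -cats1; congr (_ ++ _).
move: sum_rs; rewrite -[X in sumn X](cat_take_drop d) takeE.
rewrite sumn_cat sumn_nseq mul1n.
have : size (drop d [seq val k | k <- tval rs]) = 1%N.
  by rewrite size_drop size_map size_tuple subSnn.
case: (drop d _) => [|k [|//]] //= _; rewrite addn0 addnC eqn_add2r.
by move/eqP->.
Qed.
End UnitLines.

(** * Evaluation on the edge *)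

Lemma prod_natr_bool (F : comPzRingType) r (P : pred 'I_r) :
  \prod_(k < r) (P k)%:R = [forall k, P k]%:R :> F.
Proof.
have [/forallP allP|] := boolP [forall k, P k].
  by rewrite big1 // => k _; rewrite allP.
rewrite negb_forall => /existsP[k /negPf Pk].
by rewrite (bigD1 k) //= Pk mul0r.
Qed.

Lemma cone_basis_edge (F : comPzRingType) r l (a : pred 'I_r)
    (u : l.-tuple 'I_r) (p : 'I_l) k :
  cone_basis F a k (vertices edge (aw_verts u (step_cut l p) k))
  = ((count_mem k (take p.+1 u) == a k) && (count_mem k (drop p u) == 1%N))%:R.
Proof.
rewrite aw_verts_step_cut vertices_edge ffunE; case: (a k) => /=.
  by rewrite /dual_fun DeltaS_eq_edge.
by rewrite /dual_fun DeltaS_eq_vertex1.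
Qed.

(** The labels of the factors e in w(e, ..., e, c, ..., c). *)
Definition initial_labels r s : seq 'I_r :=
  [seq k : 'I_r <- enum 'I_r | (k < s)%N].

Lemma val_initial_labels r s : (s <= r)%N ->
  [seq val i | i <- initial_labels r s] = iota 0 s.
Proof.
move=> sr; rewrite /initial_labels -(filter_map val (fun k => k < s)%N).
rewrite val_enum_ord -[r](subnKC sr) iotaD filter_cat add0n.
rewrite (_ : filter _ (iota 0 s) = iota 0 s); last first.
  by apply/all_filterP/allP=> i; rewrite mem_iota.
rewrite (_ : filter _ _ = [::]) ?cats0 //.
apply/eqP; rewrite -[_ == _]negbK -has_filter; apply/hasPn=> i.
by rewrite mem_iota -leqNgt => /andP[].
Qed.

Lemma size_initial_labels r s : (s <= r)%N -> size (initial_labels r s) = s.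
Proof.
by move=> sr; rewrite -(size_map val) val_initial_labels // size_iota.
Qed.

Lemma initial_labels_uniq r s : uniq (initial_labels r s).
Proof. exact: (filter_uniq _ (enum_uniq 'I_r)). Qed.

Lemma mem_initial_labels r s (k : 'I_r) :
  (k \in initial_labels r s) = (k < s)%N.
Proof.
apply: etrans (mem_filter (fun k : 'I_r => k < s)%N k (enum 'I_r)) _.
by rewrite mem_enum andbT.
Qed.

(** The labels for which every C_(k), with respect to the cut at p, is (0, 1)
    if k < s and (1) otherwise. *)
Definition cut_compatible r l s p (u : l.-tuple 'I_r) : bool :=
  perm_eq (take p.+1 u) (initial_labels r s) && perm_eq (drop p u) (enum 'I_r).

Lemma cut_compatibleE r l s p (u : l.-tuple 'I_r) :
  cut_compatible s p u
  = [forall k : 'I_r, (count_mem k (take p.+1 u) == (k < s)%N)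
                      && (count_mem k (drop p u) == 1%N)].
Proof.
have cI (j : 'I_r) : count_mem j (initial_labels r s) = (j < s)%N.
  by rewrite count_uniq_mem ?initial_labels_uniq // mem_initial_labels.
have cE (j : 'I_r) : count_mem j (enum 'I_r) = 1%N.
  by rewrite count_uniq_mem ?enum_uniq // mem_enum.
apply/idP/forallP => [/andP[/seq.permP pI /seq.permP pE] k|cnt].
  by rewrite pI pE cI cE !eqxx.
apply/andP; split; apply/allP=> k _ /=; have /andP[/eqP c1 /eqP c2] := cnt k;
  by rewrite ?c1 ?c2 ?cI ?cE.
Qed.

(** Both segments have prescribed lengths: p + 1 = s and (r + d) - p = r. *)
Lemma cut_compatible_index r d s (p : 'I_(r + d)) (u : (r + d).-tuple 'I_r) :
  (s <= r)%N -> cut_compatible s p u -> p.+1 = s /\ p = d :> nat.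
Proof.
move=> sr /andP[/perm_size pI /perm_size pE]; have pl := ltn_ord p.
move: pI pE; rewrite size_initial_labels // size_drop size_take size_tuple.
rewrite -cardE card_ord.
by case: ltngtP; lia.
Qed.

(** The Koszul exponent of the pairing, for s simplices of dimension one
    followed by simplices of dimension zero. *)
Lemma sum_pairs_initial r s : (s <= r)%N ->
  (\sum_(i < r) \sum_(j < r | i < j) (i < s) * (j < s) = (s * (s - 1))./2)%N.
Proof.
move=> sr; rewrite subn1 -bin2 -bin2_sum (exchange_big_dep predT) //=.
rewrite big_mkord (big_ord_widen_cond r predT (fun j => j)) //=.
rewrite [RHS]big_mkcond /=.
apply: eq_bigr => j _; case: ifP => js; last first.
  by rewrite big1 // => i _; rewrite muln0.
transitivity (\sum_(i < r | i < j) 1)%N.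
  by apply: eq_bigr => i ij; rewrite (ltn_trans ij js).
by rewrite -(big_ord_widen r (fun=> 1%N)) ?sum1_card ?card_ord // ltnW.
Qed.

Section CutCompatible.
Variables (r l s : nat) (p : 'I_l) (u : l.-tuple 'I_r).
Hypothesis up : cut_compatible s p u.

(** The segment from p on contains every label once: nothing recurs inside it,
    and everything before it recurs there. *)
Lemma cut_compatible_final i : final_interval u i = (p <= i)%N.
Proof.
have /andP[_ pE] := up; case: (leqP p i) => pi; last first.
  apply/negbTE; rewrite negb_forall.
  have: tnth u i \in drop p u by rewrite (perm_mem pE) mem_enum.
  case/(nthP (tnth u i)) => j; rewrite size_drop size_tuple => jl.
  rewrite nth_drop => uj; have jl' : (p + j < l)%N by lia.
  apply/existsP; exists (Ordinal jl'); rewrite negb_imply /= negbK.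
  apply/andP; split.
    by apply: leq_trans pi _; rewrite leq_addr.
  by rewrite (tnth_nth (tnth u i)) /= uj.
have x0 : 'I_r := tnth u i.
apply/forallP=> j; apply/implyP=> ij; apply/negP.
rewrite !(tnth_nth x0) -[val i](subnKC pi).
rewrite -[val j](subnKC (leq_trans pi (ltnW ij))) -!nth_drop nth_uniq.
- by apply/negP; lia.
- by rewrite size_drop size_tuple; have := ltn_ord j; lia.
- by rewrite size_drop size_tuple; have := ltn_ord i; lia.
- by rewrite (perm_uniq pE) enum_uniq.
Qed.

(** Inner intervals end at 0. Before p the intervals have length one for being
    inner, at p for joining 0 to 1, and after p the length is zero. *)
Lemma cut_compatible_aw_exp : aw_exp u (step_cut l p)
  = (\sum_(i < l) \sum_(j < l | (i < j) && (tnth u j < tnth u i))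
       (i <= p) * (j <= p))%N.
Proof.
have lenE i : interval_length u (step_cut l p) i = (i <= p)%N.
  rewrite /interval_length cut_compatible_final /lo /hi !nth_step_cut ?ltn_ord //.
    by case: ltngtP => /=; lia.
  by rewrite ltnW.
rewrite /aw_exp big1 ?add0n => [|i]; last first.
  rewrite cut_compatible_final -ltnNge /hi nth_step_cut // => ip.
  by rewrite ltnNge ip.
by apply: eq_bigr => i _; apply: eq_bigr => j _; rewrite !lenE.
Qed.
End CutCompatible.

(** The sign of the pairing is constant on the terms that survive, hence can be
    written in front of all of them. *)
Lemma aw_term_edge (F : comPzRingType) r l s (u : l.-tuple 'I_r) (p : 'I_l) :
  (s <= r)%N ->
  aw_term (cone_basis F (fun k : 'I_r => k < s)%N) edge u (step_cut l p)
  = (-1) ^+ (s * (s - 1))./2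
    * ((-1) ^+ aw_exp u (step_cut l p) * (cut_compatible s p u)%:R).
Proof.
move=> sr; rewrite /aw_term.
under [X in _ * (_ * X)]eq_bigr do rewrite cone_basis_edge.
rewrite prod_natr_bool -cut_compatibleE.
case: (boolP (cut_compatible s p u)) => [|_]; last by rewrite !mulr0.
rewrite cut_compatibleE => /forallP cnt; rewrite !mulr1 mulrC; congr (_ ^+ _ * _).
rewrite -(sum_pairs_initial sr); apply: eq_bigr => i _; apply: eq_bigr => j _.
have dimE k : sdim (vertices edge (aw_verts u (step_cut l p) k)) = (k < s)%N.
  have /andP[/eqP c1 /eqP c2] := cnt k.
  by rewrite aw_verts_step_cut c1 c2 /sdim /= size_cat !size_nseq addn1.
by rewrite !dimE.
Qed.

Lemma sum_ord_narrow m n (G : nat -> nat) : (m <= n)%N ->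
  (forall i, (m <= i)%N -> G i = 0%N) ->
  (\sum_(i < n) G i = \sum_(i < m) G i)%N.
Proof.
move=> mn G0; rewrite (big_ord_widen n G mn) [RHS]big_mkcond /=.
by apply: eq_bigr => i _; case: ltnP => // /G0.
Qed.

(** Only the first s = p + 1 intervals have odd length, and there u lists the
    values of q. *)
Lemma cut_compatible_sign r l s p (u : l.-tuple 'I_r) (q : 'S_s) :
  p.+1 = s -> (s <= l)%N ->
  [seq val i | i <- codom q] = [seq val i | i <- take s u] ->
  odd (\sum_(i < l) \sum_(j < l | (i < j) && (tnth u j < tnth u i))
       (i <= p) * (j <= p))%N = odd_perm q.
Proof.
move=> ps sl qE; rewrite odd_perm_inversions; congr odd.
pose v i := nth 0%N [seq val i | i <- tval u] i.
have vu (i : 'I_l) : tnth u i = v i :> nat.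
  by rewrite /v (nth_map (tnth u i)) ?size_tuple // -tnth_nth.
have vq (i : 'I_s) : q i = v i :> nat.
  have := congr1 (fun t => nth 0%N t i) qE.
  rewrite map_take nth_take // -/(v i) => <-.
  rewrite (nth_map i) ?size_codom ?card_ord // /codom /image_mem.
  by rewrite (nth_map i) ?size_enum_ord // nth_ord_enum.
pose H i j := (((i < j) && (v j < v i)) * ((i <= p) * (j <= p)))%N.
pose G i := (\sum_(j < l) H i j)%N.
transitivity (\sum_(i < l) G i)%N.
  apply: eq_bigr => i _; rewrite big_mkcond /=; apply: eq_bigr => j _.
  by rewrite /H !vu; case: ifP => _; rewrite ?mul1n ?mul0n.
rewrite (sum_ord_narrow sl) => [|i si]; last first.
  by rewrite /G big1 // => j _; rewrite /H [(i <= p)%N]leqNgt ps si /= muln0.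
apply: eq_bigr => i _; rewrite /G.
rewrite (sum_ord_narrow (G := H i) sl) => [|j sj]; last first.
  by rewrite /H [(j <= p)%N]leqNgt ps sj /= !muln0.
rewrite [RHS]big_mkcond; apply: eq_bigr => j _.
have le_p (k : 'I_s) : (k <= p)%N by rewrite -ltnS ps.
by rewrite /H !le_p !vq muln1; case: (i < j)%N.
Qed.

Lemma perm_initial_labels r s (t : seq 'I_r) : (s <= r)%N ->
  perm_eq t (initial_labels r s) = perm_eq [seq val i | i <- t] (iota 0 s).
Proof.
move=> sr; rewrite -(val_initial_labels sr); apply/idP/idP.
  exact: perm_map.
exact: (perm_map_inj val_inj).
Qed.

Lemma iota_permP s (t : seq nat) :
  reflect (exists q : 'S_s, [seq val i | i <- codom q] = t)
          (perm_eq t (iota 0 s)).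
Proof.
apply: (iffP idP) => [tE|[q <-]].
  have sz : size t = s by rewrite (perm_size tE) size_iota.
  have lt_s (i : 'I_s) : (nth 0 t i < s)%N.
    have : nth 0%N t i \in t by rewrite mem_nth // sz.
    by rewrite (perm_mem tE) mem_iota.
  have inj : injective (fun i => Ordinal (lt_s i)).
    move=> i j /(congr1 val)/eqP /=; rewrite nth_uniq ?sz //.
      by move/eqP/val_inj.
    by rewrite (perm_uniq tE) iota_uniq.
  exists (perm inj); apply: (@eq_from_nth _ 0%N).
    by rewrite size_map size_codom card_ord sz.
  move=> i; rewrite size_map size_codom card_ord => si.
  rewrite (nth_map (Ordinal si)) ?size_codom ?card_ord // /codom /image_mem.
  by rewrite (nth_map (Ordinal si)) ?size_enum_ord // permE /= nth_enum_ord.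
rewrite -val_enum_ord; apply: perm_map; apply: uniq_perm.
- exact: codom_perm_uniq.
- exact: enum_uniq.
- move=> i; rewrite mem_enum; apply/codomP.
  by exists (q^-1 i)%g; rewrite permKV.
Qed.

(** The factor [0 < s] accounts for w(c, ..., c), for which no subdivision of
    the edge is compatible: one of its pieces is the edge itself. *)
Lemma eval_gen_edge (F : comPzRingType) r d (b : be_gen r.+1 d) s :
  (s <= r.+1)%N ->
  eval_gen b (cone_basis F (fun k : 'I_r.+1 => k < s)%N) edge
  = (0 < s)%N%:R * ((-1) ^+ (s * (s - 1))./2 * eps_gen F s b).
Proof.
move=> sr; rewrite /eval_gen -signr_odd.
(* On the edge the sign of the evaluation has the even exponent d (d + 1). *)
have -> : odd (d * (sdim edge + d)) = false.
  by rewrite oddM oddD /sdim /=; case: (odd d).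
rewrite mul1r.
under eq_bigr => u _.
  rewrite -[sdim edge]/1%N sum_cuts1.
  under eq_bigr do rewrite aw_term_edge //.
  over.
have leadsE : [seq val i | i <- leads b] = [seq leading w | w <- b].
  by rewrite -map_comp; apply: eq_map => w; rewrite /= leadingE.
(* If d + 1 <> s no cut is compatible, and epsilon_s with s > 0 vanishes in
   degree d. *)
have [ds|/eqP ds] := eqVneq d.+1 s; last first.
  rewrite big1 => [|u _]; last first.
    rewrite big1 ?mulr0 // => p _; case: (boolP (cut_compatible s p u)) => [up|_].
      by have [ps pd] := cut_compatible_index sr up; case: ds; rewrite -ps pd.
    by rewrite !mulr0.
  case: s ds sr => [|s] ds sr; rewrite ?mul0r // mul1r /eps_gen.
  case: pickP => [q /eqP /(congr1 size)|_]; last by rewrite mulr0.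
  by rewrite size_map size_codom card_ord size_map size_tuple => sd; case: ds.
rewrite -ds mul1r in sr *.
have dl : (d < r.+1 + d)%N by rewrite addSn ltnS leq_addl.
transitivity (\sum_(u : surj_gen r.+1 d) (-1) ^+ (d.+1 * (d.+1 - 1))./2 *
   ((tval u == unit_lines b)%:R * ((-1) ^+ aw_exp u (step_cut (r.+1 + d) d) *
   (cut_compatible d.+1 d u)%:R)) : F).
  apply: eq_bigr => u _.
  rewrite (bigD1 (Ordinal dl)) //= big1 ?addr0 => [|p pd]; last first.
    case: (boolP (cut_compatible d.+1 p u)) => [up|_]; last by rewrite !mulr0.
    have [_ pd'] := cut_compatible_index sr up.
    by case/eqP: pd; apply: val_inj.
  rewrite mulrCA; congr (_ * _).
  case: (boolP (cut_compatible d.+1 d u)) => [/andP[_ du]|_].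
    by rewrite TR_gen_unit_lines.
  by rewrite !mulr0.
rewrite -big_distrr; congr (_ * _).
(* The permutation defining epsilon_s exists iff the remaining surjection is
   compatible with the cut at d. *)
rewrite /eps_gen; case: pickP => [q /eqP qE|no_q]; last first.
  rewrite big1 // => u _; case: eqP => [uE|_]; last by rewrite mul0r.
  case: (boolP (cut_compatible d.+1 d u)) => [/andP[+ _]|_]; last by rewrite !mulr0.
  rewrite uE take_unit_lines perm_initial_labels // leadsE => /iota_permP[q qE].
  by have := no_q q; rewrite qE eqxx.
have up : perm_eq (leads b) (initial_labels r.+1 d.+1).
  by rewrite perm_initial_labels // leadsE; apply/iota_permP; exists q.
have [|u0 u0E] := @unit_lines_surjection r d b.
  by rewrite (perm_uniq up) initial_labels_uniq.
have up0 : cut_compatible d.+1 d u0.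
  by rewrite /cut_compatible u0E take_unit_lines up drop_unit_lines.
rewrite (bigD1 u0) //= big1 ?addr0 => [|u uu0]; last first.
  case: eqP => [uE|_]; last by rewrite mul0r.
  by case/eqP: uu0; apply/val_inj/val_inj; rewrite /= uE.
rewrite u0E eqxx mul1r up0 mulr1 -signr_odd.
rewrite (@cut_compatible_aw_exp _ _ _ (Ordinal dl) _ up0).
rewrite (cut_compatible_sign (q := q)) //.
by rewrite u0E take_unit_lines leadsE.
Qed.

(** * Evaluation on the vertex *)

Lemma cone_e_vertices_vertex1 F c : cone_e F (vertices vertex1 c) = 0.
Proof.
rewrite /vertices; move: (seq_smap (sdim vertex1) c).
case: (size c).-1 => [|m] a.
  by rewrite /= /dual_fun; case: eqP => // /(congr1 (@sdim _)).
by rewrite rcochain_degenerate //; exists 0%N, a, (tagged vertex1).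
Qed.

(** A simplex of positive dimension all of whose vertices coincide is
    degenerate. *)
Lemma cone_c_vertices_vertex1 F c :
  cone_c F (vertices vertex1 c) = (size c <= 1)%N%:R.
Proof.
have -> : (size c <= 1)%N = ((size c).-1 == 0%N) by case: (size c) => [|[]].
rewrite /vertices; move: (seq_smap (sdim vertex1) c).
case: (size c).-1 => [|m] a.
  rewrite (_ : a = sid 0) ?sact_id /= /dual_fun ?eqxx //.
  by apply/val_inj/ffunP=> i; rewrite [LHS]ord1 [RHS]ord1.
by rewrite rcochain_degenerate //; exists 0%N, a, (tagged vertex1).
Qed.

Lemma sum_cuts0 (V : nmodType) l (G : seq nat -> V) :
  \sum_(ns <- cuts l 0) G ns = G (nseq l.+1 0%N).
Proof.
rewrite (perm_big [:: nseq l.+1 0%N]) ?big_seq1 //.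
apply: uniq_perm; rewrite ?cuts_uniq // => ns; rewrite inE.
apply/cutsP/eqP => [[sz ub _ _ _]|->].
  apply: (@eq_from_nth _ 0%N); rewrite ?size_nseq // => i il.
  rewrite nth_nseq if_same; apply/eqP; rewrite -leqn0.
  by apply: (allP ub); rewrite mem_nth.
split; rewrite ?size_nseq ?all_nseq ?nth_nseq ?if_same //.
by apply/(sortedP 0%N) => i _; rewrite !nth_nseq !if_same.
Qed.

Lemma aw_verts_constant_cut r l (u : l.-tuple 'I_r) k :
  aw_verts u (nseq l.+1 0%N) k = nseq (count_mem k u) 0%N.
Proof.
rewrite /aw_verts (@flatten_constant_intervals _ _ 0); last first.
  by apply/allP=> i _; rewrite /lo /hi !nth_nseq !if_same.
by congr nseq; rewrite -[in RHS](map_tnth_enum u) [RHS]count_map.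
Qed.

Lemma surj_gen_uniq r d (u : surj_gen r d) : uniq u = (d == 0%N).
Proof.
have /andP[/forallP su _] := valP u; have szu := size_tuple u.
apply/idP/eqP => [/card_uniqP uu|d0].
  by have := max_card (mem (tval u)); rewrite uu szu card_ord; lia.
apply: (@leq_size_uniq _ (enum 'I_r)); rewrite ?enum_uniq //.
by rewrite szu size_enum_ord d0 addn0.
Qed.

Lemma count_le1_uniq r (t : seq 'I_r) :
  [forall k : 'I_r, (count_mem k t <= 1)%N] = uniq t.
Proof.
apply/forallP/idP => [cnt|ut k]; last by rewrite count_uniq_mem // leq_b1.
apply: count_mem_uniq => x; have := cnt x; rewrite -has_pred1 has_count.
by case: count => [|[]].
Qed.

Lemma aw_term_vertex1 (F : comPzRingType) r d (u : surj_gen r d) :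
  aw_term [ffun=> cone_c F] vertex1 u (nseq (r + d).+1 0%N) = (d == 0%N)%:R.
Proof.
rewrite /aw_term; under [X in _ * (_ * X)]eq_bigr do
  rewrite ffunE cone_c_vertices_vertex1 aw_verts_constant_cut size_nseq.
rewrite prod_natr_bool count_le1_uniq surj_gen_uniq.
case: (eqVneq d 0%N) => [d0|]; last by rewrite !mulr0.
have uu : uniq u by rewrite surj_gen_uniq d0.
have fin i : final_interval u i.
  apply/forallP=> j; apply/implyP=> ij.
  by rewrite (inj_eq (tuple_uniqP _ uu)) neq_ltn ij orbT.
rewrite [aw_exp _ _](_ : _ = 0%N); last first.
  rewrite /aw_exp big1 => [|i]; last by rewrite fin.
  rewrite big1 // => i _; rewrite big1 // => j _.
  by rewrite /interval_length fin /lo /hi !nth_nseq !if_same.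
rewrite big1 ?mulr1 // => i _; rewrite big1 // => j _.
rewrite /sdim /= !aw_verts_constant_cut !size_nseq count_uniq_mem //.
by case: (_ \in _).
Qed.

Lemma eval_gen_vertex1 (F : comPzRingType) r d (b : be_gen r.+1 d) :
  eval_gen b [ffun=> cone_c F] vertex1 = (d == 0%N)%:R.
Proof.
rewrite /eval_gen -[sdim vertex1]/0%N.
under eq_bigr do rewrite sum_cuts0 aw_term_vertex1.
case: d b => [|d] b; last by rewrite big1 ?mulr0 // => u _; rewrite mulr0.
have [|u0 u0E] := @unit_lines_surjection r 0 b.
  by have := size_leads b; case: (leads b) => [|x [|]].
rewrite mul0n expr0 mul1r (bigD1 u0) //=.
rewrite big1 => [|u uu0]; rewrite ?mulr1 TR_gen_unit_lines.
- by rewrite u0E eqxx addr0.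
- by rewrite u0E drop_unit_lines.
- case: eqP => // uE; case/eqP: uu0; apply/val_inj/val_inj.
  by rewrite /= uE.
- rewrite drop0; apply: uniq_perm; rewrite ?enum_uniq ?surj_gen_uniq // => k.
  by rewrite mem_enum; have /andP[/forallP ->] := valP u.
Qed.

(** * The circle and cone algebras *)

Lemma evaluation_edge (F : comPzRingType) r d (w : barratt_eccles F r.+1 d) s :
  (s <= r.+1)%N ->
  evaluation_fun w (cone_basis F (fun k : 'I_r.+1 => k < s)%N) edge
  = (0 < s)%N%:R * ((-1) ^+ (s * (s - 1))./2 * eps s w).
Proof.
move=> sr; rewrite evaluation_funE /eps !big_distrr; apply: eq_bigr => b _.
by rewrite eval_gen_edge //= mulrCA; congr (_ * _); rewrite mulrCA.
Qed.

Lemma evaluation_vertex1_e (F : comPzRingType) r d (w : barratt_eccles F r d)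
    (f : {ffun 'I_r -> rcochain F simplicial_interval}) k :
  f k = cone_e F -> evaluation_fun w f vertex1 = 0.
Proof.
move=> fk; rewrite /evaluation_fun pairing_eq0 ?mulr0 // => u ns _.
by exists k; rewrite fk cone_e_vertices_vertex1.
Qed.

Lemma evaluation_vertex1_c (F : comPzRingType) r d
    (w : barratt_eccles F r.+1 d) :
  evaluation_fun w [ffun=> cone_c F] vertex1 = eps 0 w.
Proof.
by rewrite evaluation_funE; apply: eq_bigr => b _; rewrite eval_gen_vertex1.
Qed.

Lemma cone_basis_all_e F r :
  [ffun=> cone_e F] = cone_basis F (fun k : 'I_r => k < r)%N.
Proof. by apply/ffunP=> k; rewrite !ffunE ltn_ord. Qed.

Lemma evaluation_cone_equations (F : comPzRingType) r (r_gt0 : (0 < r)%N) :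
  cone_equations (@evaluation F simplicial_interval r r_gt0).
Proof.
case: r r_gt0 => // r r_gt0.
have edge_e : cone_e F edge = 1 by rewrite /= /dual_fun eqxx.
have edge_c : cone_c F edge = 0.
  by rewrite /= /dual_fun; case: eqP => // /(congr1 (@sdim _)).
have vertex1_c : cone_c F vertex1 = 1 by rewrite /= /dual_fun eqxx.
have vertex1_e : cone_e F vertex1 = 0.
  by rewrite /= /dual_fun; case: eqP => // /(congr1 (@sdim _)).
have with_e s d (w : barratt_eccles F r.+1 d) : (0 < s <= r.+1)%N ->
    evaluation r_gt0 w (cone_basis F (fun k : 'I_r.+1 => k < s)%N)
    = ((-1) ^+ (s * (s - 1))./2 * eps s w) *: cone_e F.
  case/andP=> s_gt0 sr; apply: interval_cochain_ext.
    rewrite -[RHS]/(_ * cone_e F edge) edge_e mulr1 /= evaluation_edge //.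
    by rewrite s_gt0 mul1r.
  rewrite -[RHS]/(_ * cone_e F vertex1) vertex1_e mulr0 /=.
  by apply: (@evaluation_vertex1_e _ _ _ _ _ ord0); rewrite ffunE s_gt0.
split=> [d w|s /andP[s_gt0 sr] d w|d w].
- by rewrite cone_basis_all_e with_e ?leqnn.
- by rewrite -/(cone_basis F (fun k : 'I_r.+1 => k < s)%N) with_e // s_gt0 ltnW.
- rewrite mul0n expr0 mul1r; apply: interval_cochain_ext.
    rewrite -[RHS]/(_ * cone_c F edge) edge_c mulr0 /=.
    by have := evaluation_edge w (leq0n r.+1); rewrite mul0r.
  rewrite -[RHS]/(_ * cone_c F vertex1) vertex1_c mulr1 /=.
  exact: evaluation_vertex1_c.
Qed.

Theorem theorem3p2p4 (F : comPzRingType) (r : nat) (r_ge1 : (1 <= r)%N) :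
  (forall (d : nat) (w : barratt_eccles F r d),
     evaluation r_ge1 w [ffun=> circle_e F]
     = ((-1) ^+ (r * (r - 1))./2 * eps r w) *: circle_e F) /\
  [/\ multilinear (@evaluation F simplicial_interval r r_ge1),
      equivariant (@evaluation F simplicial_interval r r_ge1),
      cone_equations (@evaluation F simplicial_interval r r_ge1)
    & forall mu : operation F simplicial_interval r,
        multilinear mu -> equivariant mu -> cone_equations mu ->
        forall (d : nat) (w : barratt_eccles F r d)
               (f : {ffun 'I_r -> rcochain F simplicial_interval}),
          mu d w f = evaluation r_ge1 w f].
Proof.
have lin := @evaluation_multilinear F simplicial_interval r r_ge1.
have equi := @evaluation_equivariant F simplicial_interval r r_ge1.
have cone := @evaluation_cone_equations F r r_ge1.
split=> [d w|].
  apply: circle_cochain_ext; rewrite evaluation_circle; have [-> _ _] := cone.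
  rewrite -[LHS]/(_ * cone_e F edge) -[RHS]/(_ * circle_e F loop).
  by rewrite /= /dual_fun !eqxx.
by split=> // mu lmu emu mu_cone; apply: cone_operation_unique.
Qed.
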